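(* Let $T\in(0,+\infty]$. Assume there are a constant $K>0$ and a real $\beta\le\frac12$ such that $a_{j,k}\le K(jk)^\beta$ for all $j,k\in\mathbb N$. Then for each $c_0\in X_1^+$ there is one and only one density nonincreasing solution $c$ of the RBK system on $[0,T)$ such that $c(0)=c_0$.
   Context: The rate coefficients $a_{j,k}$ ($j,k\in\mathbb N=\{1,2,\dots\}$) are real with $a_{j,k}=a_{k,j}\ge 0$. The Redner--Ben-Avraham--Kahng (RBK) system is $$\frac{dc_j}{dt}=\sum_{k=1}^\infty a_{j+k,k}c_{j+k}c_k-\sum_{k=1}^\infty a_{j,k}c_jc_k,\qquad j\in\mathbb N.$$ $X_1=\{x=(x_j)\in\mathbb R^{\mathbb N}: \|x\|_1:=\sum_{j=1}^\infty j|x_j|<\infty\}$ and $X_1^+=\{x\in X_1: x_j\ge 0\ \forall j\}$. Definition (solution). Let $T\in(0,+\infty]$. A (mild) solution of the RBK system on $[0,T)$ with $c(0)=c_0\in X_1^+$ is a function $c=(c_j):[0,T)\to X_1^+$ such that: (i) each $c_j:[0,T)\to[0,\infty)$ is continuous and $\sup_{t\in[0,T)}\|c(t)\|_1<\infty$; (ii) for all $j\in\mathbb N$ and $t\in[0,T)$, $\int_0^t\sum_{k=1}^\infty a_{j,k}c_k(s)\,ds<\infty$; (iii) for all $j\in\mathbb N$ and $t\in[0,T)$, $$c_j(t)=c_{0j}+\int_0^t\Big[\sum_{k=1}^\infty a_{j+k,k}c_{j+k}(s)c_k(s)-\sum_{k=1}^\infty a_{j,k}c_j(s)c_k(s)\Big]ds.$$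 A solution $c$ is density nonincreasing if $\|c(t_2)\|_1\le\|c(t_1)\|_1$ for all $t_2\ge t_1$ in its interval of definition. *)

(* Defs.v *)
From HB Require Import structures.
From mathcomp Require Import all_boot all_order all_algebra.
From mathcomp Require Import all_classical all_reals all_analysis.
Set Implicit Arguments.
Unset Strict Implicit.
Unset Printing Implicit Defensive.
Import Order.TTheory GRing.Theory Num.Theory.
Import numFieldNormedType.Exports.
Local Open Scope classical_set_scope.
Local Open Scope ring_scope.

(* Sequences indexed by {1, 2, ...} are functions on nat whose value at 0 is
   never used: sums start at 1 and quantifiers are restricted to 0 < j. *)

Definition norm1 (R : realType) (x : nat -> R) : \bar R :=
  (\sum_(1 <= j <oo) (j%:R * `|x j|)%:E)%E.

Definition X1 (R : realType) : set (nat -> R) :=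
  [set x | (norm1 x < +oo)%E].

Definition X1plus (R : realType) : set (nat -> R) :=
  [set x | X1 x /\ forall j : nat, (0 < j)%N -> 0 <= x j].

Definition time_interval (R : realType) (T : \bar R) : set R :=
  [set t | 0 <= t /\ (t%:E < T)%E].

Definition RBK_gain (R : realType) (a : nat -> nat -> R) (x : nat -> R)
    (j : nat) : \bar R :=
  (\sum_(1 <= k <oo) (a (j + k)%N k * x (j + k)%N * x k)%:E)%E.

Definition RBK_loss (R : realType) (a : nat -> nat -> R) (x : nat -> R)
    (j : nat) : \bar R :=
  (\sum_(1 <= k <oo) (a j k * x j * x k)%:E)%E.

(* The last clause is an equality in \bar R whose left-hand side is finite.
   By the integrability clause the loss term is integrable on [0, t], so the
   equality also forces the gain term to be integrable; the convention for
   +oo - +oo can only matter on a null set. *)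
Definition RBK_solution (R : realType) (a : nat -> nat -> R) (T : \bar R)
    (c0 : nat -> R) (c : R -> nat -> R) : Prop :=
  [/\ (forall t : R, time_interval T t -> X1plus (c t)),
      (forall j : nat, (0 < j)%N -> c 0 j = c0 j),
      (forall j : nat, (0 < j)%N ->
         {within time_interval T, continuous (fun t : R => c t j)}) /\
      (ereal_sup [set norm1 (c t) | t in time_interval T] < +oo)%E,
      (forall (j : nat) (t : R), (0 < j)%N -> time_interval T t ->
         (\int[lebesgue_measure]_(s in `[0%R, t])
            (\sum_(1 <= k <oo) (a j k * c s k)%:E) < +oo)%E)
    & (forall (j : nat) (t : R), (0 < j)%N -> time_interval T t ->
         ((c t j)%:E = (c0 j)%:E +
           \int[lebesgue_measure]_(s in `[0%R, t])
             (RBK_gain a (c s) j - RBK_loss a (c s) j))%E)].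

Definition density_nonincreasing (R : realType) (T : \bar R)
    (c : R -> nat -> R) : Prop :=
  forall t1 t2 : R, time_interval T t1 -> time_interval T t2 -> t1 <= t2 ->
    (norm1 (c t2) <= norm1 (c t1))%E.

(* Main.v *)
(* Since beta <= 1/2, the kernel satisfies a j k <= K w_j w_k with w_j = sqrt j.
   If g is nondecreasing with g 0 = 0, the system truncated to sizes below N
   satisfies sum_j g_j F_j <= 0, because collisions only shrink clusters, and on
   the set of states of mass at most M the truncation changes
   sum_(j < N) |F_j| by at most 2 K M^2 / w_N, uniformly in time.
   With g_j = min(j, m) this shows that every solution is density nonincreasing.

   For two solutions c and d with z = c - d, the dissipative part of the loss
   term gives
     d/dt sum_j g_j |z_j| <= 2 K M sum_j w_j |z_j|   whenever g <= w.
   Taking g_j = min(w_j, m), so that sum_j w_j |z_j| exceeds sum_j g_j |z_j| by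
   at most 2 M / m, and N = m^4, Gronwall's lemma and m -> oo give uniqueness
   (even without assuming that the density is nonincreasing).

   Solutions are obtained as the pointwise limit, along an ultrafilter, of Euler
   schemes for the systems truncated at n with step tending to 0.  These schemes
   preserve positivity and do not increase the mass, and the same tail bounds
   make the defect |c_j(t) - c_j(s) - (t - s) F_j(c(s))| an o(t - s), uniformly
   in n, so that the limit has right derivative F_j(c). *)
Require Import Defs.
From mathcomp Require Import all_boot all_order all_algebra.
From mathcomp Require Import all_classical all_reals all_analysis.
From mathcomp Require Import measurable_realfun lra ring.
Import Order.TTheory GRing.Theory Num.Theory.
Import numFieldNormedType.Exports.
Local Open Scope classical_set_scope.
Local Open Scope ring_scope.
Set Implicit Arguments.
Unset Strict Implicit.
Unset Printing Implicit Defensive.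

(** * Right derivatives and Gronwall's lemma *)

Section RightDerivative.
Variable R : realType.
Implicit Types (f g y : R -> R) (A : set R).

Lemma within_continuous_epsP A f :
  {within A, continuous f} <->
  forall x, A x -> forall e, 0 < e -> exists2 d, 0 < d &
    forall z, A z -> `|z - x| < d -> `|f z - f x| < e.
Proof.
split=> [/subspace_continuousP cf x Ax e e0|cf].
  have /cvgrPdist_lt/(_ _ e0) := cf _ Ax.
  rewrite near_withinE => -[d /= d0 dP]; exists d => // z Az zx.
  by rewrite distrC; apply: dP => //=; rewrite distrC.
apply/subspace_continuousP => x Ax; apply/cvgrPdist_lt => e e0.
have [d d0 dP] := cf _ Ax _ e0; rewrite near_withinE; exists d => //= z /= zx Az.
by rewrite distrC; apply: dP => //; rewrite distrC.
Qed.

Definition right_deriv f (s l : R) : Prop :=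
  forall e, 0 < e -> exists2 d, 0 < d &
    forall h, 0 < h -> h < d -> `|f (s + h) - f s - h * l| <= h * e.

(** The upper right Dini derivative of [f] at [s] is at most [l]. *)
Definition right_slope_le f (s l : R) : Prop :=
  forall e, 0 < e -> exists2 d, 0 < d &
    forall h, 0 < h -> h < d -> f (s + h) <= f s + h * (l + e).

(** By continuity, the set of [t] with [f t <= f a + e * (t - a)] contains its supremum; the slope
    bound there would give a larger element if the supremum were below [b]. The slack [e] is
    arbitrary. *)
Lemma le_of_right_slope_le0 f a b : a <= b ->
  {within `[a, b], continuous f} ->
  (forall s, a <= s -> s < b -> right_slope_le f s 0) ->
  f b <= f a.
Proof.
move=> ab /within_continuous_epsP cf sf.
apply/ler_addgt0Pr => e0 e0_gt0.
have ba0 : 0 <= b - a by rewrite subr_ge0.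
(* The added 1 keeps the denominator positive when [a = b]. *)
pose e := e0 / (b - a + 1).
have e_gt0 : 0 < e by rewrite divr_gt0 // ltr_wpDl.
have eb : e * (b - a) <= e0.
  by rewrite /e mulrAC ler_pdivrMr ?ltr_wpDl // ler_pM2l // lerDl.
pose A := [set t : R | a <= t /\ t <= b /\ f t <= f a + e * (t - a)].
have A0 : A a by split => //; split => //; rewrite subrr mulr0 addr0.
have supA : has_sup A by split; [exists a | exists b => t [_ []]].
have s_ge0 : a <= sup A by apply: sup_upper_bound.
have s_le : sup A <= b by apply: ge_sup; [exists a | move=> t [_ []]].
have fs : f (sup A) <= f a + e * (sup A - a).
  rewrite leNgt; apply/negP => hlt.
  pose eta := (f (sup A) - (f a + e * (sup A - a))) / 2.
  have eta0 : 0 < eta by rewrite divr_gt0 // subr_gt0.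
  have [|d d0 dP] := cf (sup A) _ eta eta0; first by rewrite /= in_itv /= s_ge0.
  have [t [t0 [tb ft]] ts] := sup_adherent d0 supA.
  have ts' : t <= sup A by apply: sup_upper_bound.
  have td : sup A - t < d by rewrite ltrBlDr -ltrBlDl.
  have := dP t; rewrite /= in_itv /= t0 tb => /(_ isT).
  rewrite ler0_norm ?subr_le0 // opprB => /(_ td).
  rewrite ltr_norml => /andP[h1 _].
  have : e * t <= e * sup A by rewrite ler_pM2l.
  by move: h1 ft eta0; rewrite /eta; lra.
have [<-|sb] := eqVneq (sup A) b.
  by apply: le_trans fs _; rewrite lerD2l (le_trans _ eb) // ler_pM2l // lerD2r.
have {}sb : sup A < b by rewrite lt_neqAle sb.
have [d d0 dP] := sf _ s_ge0 sb _ e_gt0.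
pose h := Num.min d (b - sup A) / 2.
have m0 : 0 < Num.min d (b - sup A) by rewrite lt_min d0 subr_gt0.
have h0 : 0 < h by rewrite divr_gt0.
have hm : h < Num.min d (b - sup A) by rewrite ltr_pdivrMr // ltr_pMr // ltr1n.
have /andP[hd hb] : (h < d) && (h < b - sup A) by rewrite -lt_min.
have : A (sup A + h).
  split; first by rewrite ler_wpDr // ltW.
  split; first by rewrite -lerBrDl ltW.
  have := dP _ h0 hd; rewrite add0r; lra.
by move/(sup_upper_bound supA); rewrite gerDl leNgt h0.
Qed.

(** The function exp(-C (t - a)) y(t) - D (t - a) has right slope at most 0, because 1 + C h <=
    exp(C h) and [y] is nonnegative. Bounding the exponential in front of [D] by 1 avoids a division
    by [C]. *)
Lemma Gronwall_right_slope y a b C D : a <= b -> 0 <= C -> 0 <= D ->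
  {within `[a, b], continuous y} -> (forall s, a <= s -> s <= b -> 0 <= y s) ->
  (forall s, a <= s -> s < b -> right_slope_le y s (C * y s + D)) ->
  y b <= expR (C * (b - a)) * (y a + D * (b - a)).
Proof.
move=> ab C0 D0 cy y0 sy.
pose f t := expR (- (C * (t - a))) * y t - D * (t - a).
have caff (c : R) : continuous (fun t => c * (t - a)).
  move=> z; apply: cvgM; first exact: cvg_cst.
  by apply: cvgB; [exact: cvg_id | exact: cvg_cst].
have : f b <= f a.
  apply: le_of_right_slope_le0 => //.
    have c1 : {within `[a, b], continuous (fun t => D * (t - a))}.
      by apply: continuous_subspaceT; exact: caff.
    have c2 : {within `[a, b], continuous (fun t => expR (- (C * (t - a))))}.
      apply: continuous_subspaceT => z.
      apply: (@continuous_comp _ _ _ (fun z => - (C * (z - a))) expR);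
        last exact: continuous_expR.
      by apply: cvgN; exact: caff.
    by move=> x; apply: cvgB; [apply: cvgM; [exact: c2 | exact: cy] | exact: c1].
  move=> s s0 sb e e0; have [d d0 dP] := sy _ s0 sb _ e0; exists d => // h h0 hd.
  have ys0 := y0 s s0 (ltW sb).
  have h1 := dP _ h0 hd.
  have Ch : 1 + C * h <= expR (C * h) by exact: expR_ge1Dx.
  have e1 : expR (- (C * (s + h - a))) * expR (C * h) = expR (- (C * (s - a))).
    by rewrite -expRD; congr expR; ring.
  have e2 : expR (- (C * (s + h - a))) <= 1.
    by rewrite -expR0 ler_expR oppr_le0 mulr_ge0 // addrAC addr_ge0 ?subr_ge0 // ltW.
  have e3 : expR (- (C * (s + h - a))) * y (s + h) <=
     expR (- (C * (s + h - a))) * (expR (C * h) * y s) + h * (D + e).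
    apply: (@le_trans _ _ (expR (- (C * (s + h - a))) * (expR (C * h) * y s + h * (D +
      e)))).
      rewrite ler_wpM2l ?expR_ge0 //; apply: le_trans h1 _.
      have : (1 + C * h) * y s <= expR (C * h) * y s by rewrite ler_wpM2r.
      lra.
    by rewrite mulrDr lerD2l ler_piMl // mulr_ge0 ?addr_ge0 // ltW.
  rewrite /f; move: e3; rewrite mulrA e1; lra.
rewrite /f !subrr !mulr0 oppr0 expR0 mul1r addr0 => h.
rewrite -(@ler_pM2l _ (expR (- (C * (b - a))))) ?expR_gt0 // mulrA -expRD addNr expR0
  mul1r.
by move: h; lra.
Qed.

Lemma right_slope_le_trans f s l l' : l <= l' ->
  right_slope_le f s l -> right_slope_le f s l'.
Proof.
move=> ll' fl e e0; have [d d0 dP] := fl _ e0; exists d => // h h0 hd.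
by apply: le_trans (dP _ h0 hd) _; rewrite lerD2l ler_pM2l // lerD2r.
Qed.

Lemma right_slope_le_sum (I : Type) (r : seq I) (F : I -> R -> R) (l : I -> R) s :
  (forall i, right_slope_le (F i) s (l i)) ->
  right_slope_le (fun t => \sum_(i <- r) F i t) s (\sum_(i <- r) l i).
Proof.
move=> Fl; elim: r => [|i r IH] e e0.
  exists 1 => // h h0 _.
  by rewrite !big_nil !add0r mulr_ge0 // ltW.
have e20 : 0 < e / 2 by rewrite divr_gt0.
have [d d0 dP] := IH _ e20; have [d' d'0 d'P] := Fl i _ e20.
exists (Num.min d d') => [|h h0]; first by rewrite lt_min d0.
rewrite lt_min => /andP[hd hd']; rewrite !big_cons.
have := lerD (d'P _ h0 hd') (dP _ h0 hd) => /le_trans; apply.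
by rewrite le_eqVlt; apply/orP; left; apply/eqP; field.
Qed.

Lemma right_slope_leZ c f s l : 0 <= c -> right_slope_le f s l ->
  right_slope_le (fun t => c * f t) s (c * l).
Proof.
move=> c0 fl e e0; have c1 : 0 < c + 1 by rewrite ltr_wpDl.
have [d d0 dP] := fl _ (divr_gt0 e0 c1); exists d => // h h0 hd.
have /le_trans := ler_wpM2l c0 (dP _ h0 hd); apply.
rewrite mulrDr lerD2l mulrCA ler_pM2l // mulrDr lerD2l mulrCA ler_piMr //;
  first exact: ltW.
by rewrite ler_pdivrMr // mul1r lerDl.
Qed.

(** Handles the term of index 0 in weighted sums: the weights vanish there, and no differential
    equation is assumed at that index. *)
Lemma right_slope_le_mul0 f s l : right_slope_le (fun t => 0 * f t) s (0 * l).
Proof.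
move=> e e0; exists 1 => // h h0 _.
by rewrite !mul0r !add0r mulr_ge0 // ltW.
Qed.

Lemma right_deriv_slope f s l : right_deriv f s l -> right_slope_le f s l.
Proof.
move=> fl e e0; have [d d0 dP] := fl _ e0; exists d => // h h0 hd.
by have := dP _ h0 hd; rewrite ler_norml => /andP[_]; lra.
Qed.

Lemma right_derivB f g s l l' : right_deriv f s l -> right_deriv g s l' ->
  right_deriv (fun t => f t - g t) s (l - l').
Proof.
move=> fl gl e e0; have e20 : 0 < e / 2 by rewrite divr_gt0.
have [d d0 dP] := fl _ e20; have [d' d'0 d'P] := gl _ e20.
exists (Num.min d d') => [|h h0]; first by rewrite lt_min d0.
rewrite lt_min => /andP[/(dP _ h0) h1 /(d'P _ h0) h2].
rewrite (_ : h * e = h * (e / 2) + h * (e / 2)); last by field.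
apply: le_trans (lerD h1 h2); apply: le_trans (ler_normB _ _).
by rewrite le_eqVlt; apply/orP; left; apply/eqP; congr `|_|; ring.
Qed.

(* Writing [z + h l = (1 - h lam) z + h (l + lam z)] makes the damping [lam]
   visible without any discussion of the sign of [z s]. *)
Lemma right_slope_le_norm f s l lam : 0 <= lam -> right_deriv f s l ->
  right_slope_le (fun t => `|f t|) s (`|l + lam * f s| - lam * `|f s|).
Proof.
move=> lam0 fl e e0; have l1 : 0 < lam + 1 by rewrite ltr_wpDl.
have [d d0 dP] := fl _ e0.
exists (Num.min d (lam + 1)^-1) => [|h h0]; first by rewrite lt_min d0 invr_gt0.
rewrite lt_min => /andP[/(dP _ h0) h1 h2].
have hl : 0 <= 1 - h * lam.
  rewrite subr_ge0 (@le_trans _ _ (h * (lam + 1))) ?ler_pM2l ?lerDl //.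
  by rewrite -ler_pdivlMr // mul1r ltW.
rewrite (_ : f (s + h) = (f (s + h) - f s - h * l) + ((1 - h * lam) * f s + h * (l + lam
  * f s))); last by ring.
have := lerD h1 (ler_normD ((1 - h * lam) * f s) (h * (l + lam * f s))).
rewrite !normrM (ger0_norm hl) (gtr0_norm h0) => /(le_trans (ler_normD _ _)) /le_trans;
  apply.
by rewrite le_eqVlt; apply/orP; left; apply/eqP; ring.
Qed.

(** The difference has right derivative 0, hence is nonincreasing, and so is its opposite. This will
    identify a function with the integral of its right derivative. *)
Lemma right_deriv_unique f g a b (l : R -> R) : a <= b ->
  {within `[a, b], continuous f} -> {within `[a, b], continuous g} ->
  (forall s, a <= s -> s < b -> right_deriv f s (l s)) ->
  (forall s, a <= s -> s < b -> right_deriv g s (l s)) ->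
  f b - f a = g b - g a.
Proof.
move=> ab.
have half f1 f2 : {within `[a, b], continuous f1} -> {within `[a, b], continuous f2} ->
  (forall s, a <= s -> s < b -> right_deriv f1 s (l s)) ->
  (forall s, a <= s -> s < b -> right_deriv f2 s (l s)) ->
  f1 b - f1 a <= f2 b - f2 a.
  move=> c1 c2 d1 d2.
  have : f1 b - f2 b <= f1 a - f2 a; last by lra.
  apply: (@le_of_right_slope_le0 (fun t => f1 t - f2 t)) => //.
    by move=> x; apply: cvgB; [exact: c1 | exact: c2].
  move=> s sa sb; rewrite -(subrr (l s)); apply: right_deriv_slope.
  by apply: right_derivB; [exact: d1 | exact: d2].
by move=> cf cg df dg; apply/eqP; rewrite eq_le !half.
Qed.

End RightDerivative.

(** * Truncated systems *)

(** Compactness of [-B, B] gives a cluster point, and an ultrafilter converges to each of its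
    cluster points. One ultrafilter thus serves all times and all sizes, in place of a diagonal
    extraction. *)
Lemma bounded_ultra_cvg (R : realType) (G : set_system nat) (f : nat -> R) (B : R) :
  UltraFilter G -> (forall n, `|f n| <= B) -> cvg (f @ G).
Proof.
move=> GU fB; have GP : ProperFilter G by exact: ultra_proper.
have [|p [_ cp]] := @segment_compact R (- B) B (f @ G).
  by apply: (@filterS _ G _ setT) filterT => n _ /=; rewrite in_itv /= -ler_norml.
apply: (@cvgP _ _ p) => A nA.
have [//|GA] := in_ultra_setVsetC (f @^-1` A) GU.
by have [x [nAx Ax]] := cp (~` A) A GA nA.
Qed.

Lemma ord_sum_split (R : realType) (N N' : nat) (P : pred nat) (f : nat -> R) :
  (N <= N')%N ->
  \sum_(i < N' | P i) f i =
  \sum_(i < N | P i) f i + \sum_(i < N' | P i && (N <= i)%N) f i.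
Proof.
move=> NN'; rewrite (bigID (fun i : 'I_N' => (i < N)%N)) /=; congr (_ + _).
  by rewrite (big_ord_widen_cond N' P f).
by apply: eq_bigl => i; rewrite -leqNgt.
Qed.

(** Substitute [k = i - j]. The pairs with [k > i] added on the right have [i - k = 0] in truncated
    subtraction, and [phi 0 = 0]. *)
Lemma sum_difference_reindex (R : realType) (N : nat) (phi : nat -> R)
    (E : nat -> nat -> R) : phi 0%N = 0 ->
  \sum_(j < N) phi j * (\sum_(i < N | (j <= i)%N) E i (i - j)%N) =
  \sum_(i < N) \sum_(k < N) phi (i - k)%N * E i k.
Proof.
move=> phi0.
under eq_bigr do rewrite mulr_sumr.
rewrite (exchange_big_dep predT) //=; apply: eq_bigr => i _.
rewrite (bigID (fun k : 'I_N => (k <= i)%N) predT) /= [X in _ + X]big1 ?addr0; last first.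
  move=> k; rewrite -ltnNge => /ltnW; rewrite -subn_eq0 => /eqP ->.
  by rewrite phi0 mul0r.
have cut (f : nat -> R) : \sum_(j < N | (j <= i)%N) f j = \sum_(j < i.+1) f j :> R.
  by rewrite (big_ord_widen_cond N predT f (ltn_ord i)).
rewrite (cut (fun j => phi j * E i (i - j)%N)) (cut (fun k => phi (i - k)%N * E i k)).
rewrite (reindex_inj rev_ord_inj) /=; apply: eq_bigr => k _.
by rewrite subSS subKn // -ltnS.
Qed.

Section Truncations.
Variables (R : realType) (a : nat -> nat -> R) (K : R).

Definition w (j : nat) : R := Num.sqrt j%:R.

Hypothesis a_sym : forall j k, a j k = a k j.
Hypothesis a_ge0 : forall j k, 0 <= a j k.
Hypothesis a_le : forall j k, a j k <= K * (w j * w k).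
Hypothesis K_ge0 : 0 <= K.

Lemma w_ge0 j : 0 <= w j. Proof. exact: sqrtr_ge0. Qed.

Lemma w_sqr j : w j * w j = j%:R.
Proof. by rewrite -expr2 sqr_sqrtr // ler0n. Qed.

Lemma w_homo i j : (i <= j)%N -> w i <= w j.
Proof. by move=> ij; rewrite ler_sqrt ?ler_nat // ler0n. Qed.

Lemma w_ge1 j : (0 < j)%N -> 1 <= w j.
Proof. by move=> j0; rewrite -[leLHS]sqrtr1 ler_sqrt ?ler1n. Qed.

Lemma w_le j : w j <= j%:R.
Proof.
case: j => [|j]; first by rewrite /w sqrtr0.
by rewrite -w_sqr ler_peMr ?w_ge0 ?w_ge1.
Qed.

Lemma w_mul_le i j : (i <= j)%N -> w i * w j <= j%:R.
Proof. by move=> ij; rewrite -w_sqr ler_wpM2r ?w_ge0 ?w_homo. Qed.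

(** The ball of radius [M] in $X_1^+$, expressed by partial sums so that only finite sums have to be
    handled. *)
Definition mass_le (M : R) (x : nat -> R) : Prop :=
  (forall j, 0 <= x j) /\ forall N, \sum_(j < N) j%:R * x j <= M.

(* The sum over [k] of [a (j + k) k * x (j + k) * x k], indexed by [i = j + k] and cut
   at [i < N] so that the truncated system is closed on the sizes below [N]. *)
Definition gain (N : nat) (x : nat -> R) (j : nat) : R :=
  \sum_(i < N | (j <= i)%N) a i (i - j)%N * x i * x (i - j)%N.

Definition loss (N : nat) (x : nat -> R) (j : nat) : R :=
  \sum_(k < N) a j k * x j * x k.

Definition rate (N : nat) (x : nat -> R) (j : nat) : R :=
  gain N x j - loss N x j.

(** * Bounds and tail estimates for states of bounded mass *)

Section MassLe.
Variables (M : R) (x : nat -> R).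
Hypothesis xM : mass_le M x.

Let x0 j : 0 <= x j. Proof. by case: xM. Qed.

Lemma mass_le_ge0 : 0 <= M.
Proof. by case: xM => _ /(_ 0%N); rewrite big_ord0. Qed.

Lemma wx_ge0 j : 0 <= w j * x j.
Proof. by rewrite mulr_ge0 ?w_ge0. Qed.

Lemma sum_w_le N : \sum_(j < N) w j * x j <= M.
Proof.
case: xM => _ /(_ N); apply: le_trans; apply: ler_sum => j _.
by rewrite ler_wpM2r // w_le.
Qed.

(** For [j >= N] one has [w N * w j <= j], so the mass controls the tail. The truncation errors
    below all come from this decay in [w N]. *)
Lemma sum_w_tail N N' :
  w N * (\sum_(j < N' | (N <= j)%N) w j * x j) <= M.
Proof.
case: xM => _ /(_ N'); apply: le_trans; rewrite mulr_sumr.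
rewrite [leRHS](bigID (fun j : 'I_N' => (N <= j)%N)) /= -[leLHS]addr0 lerD //.
  by apply: ler_sum => j Nj; rewrite mulrA ler_wpM2r // w_mul_le.
by apply: sumr_ge0 => j _; rewrite mulr_ge0.
Qed.

Lemma wx_le j : w j * x j <= M.
Proof.
have := sum_w_le j.+1; rewrite big_ord_recr /=; apply: le_trans.
by rewrite lerDr sumr_ge0 // => i _; exact: wx_ge0.
Qed.

Lemma x_le j : (0 < j)%N -> x j <= M.
Proof.
by move=> /w_ge1 wj; apply: le_trans (wx_le j); rewrite ler_peMl.
Qed.

Lemma term_ge0 i k : 0 <= a i k * x i * x k.
Proof. by rewrite !mulr_ge0. Qed.

Lemma term_le i k : a i k * x i * x k <= K * ((w i * x i) * (w k * x k)).
Proof.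
rewrite (_ : K * _ = K * (w i * w k) * x i * x k); last by ring.
by rewrite ler_wpM2r ?ler_wpM2r.
Qed.

Lemma gain_ge0 N j : 0 <= gain N x j.
Proof. by apply: sumr_ge0 => i _; exact: term_ge0. Qed.

Lemma loss_ge0 N j : 0 <= loss N x j.
Proof. by apply: sumr_ge0 => i _; exact: term_ge0. Qed.

(** Each term is at most K (w_i x_i)(w_k x_k); one factor is bounded by [M] and the other is summed,
    so the bound does not depend on [N]. *)
Lemma gain_le N j : gain N x j <= K * (M * M).
Proof.
apply: (@le_trans _ _ (\sum_(i < N) K * (M * (w i * x i)))); last first.
  by rewrite -mulr_sumr -mulr_sumr ler_wpM2l // ler_wpM2l ?mass_le_ge0 ?sum_w_le.
rewrite /gain big_mkcond /=; apply: ler_sum => i _; case: ifP => ji; last first.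
  by rewrite !mulr_ge0 ?mass_le_ge0 ?w_ge0.
apply: le_trans (term_le _ _) _; rewrite ler_wpM2l // mulrC.
by rewrite ler_wpM2r ?wx_ge0 ?wx_le.
Qed.

Lemma loss_le N j : loss N x j <= K * (M * M).
Proof.
apply: (@le_trans _ _ (\sum_(i < N) K * (M * (w i * x i)))); last first.
  by rewrite -mulr_sumr -mulr_sumr ler_wpM2l // ler_wpM2l ?mass_le_ge0 ?sum_w_le.
apply: ler_sum => i _; apply: le_trans (term_le _ _) _.
by rewrite ler_wpM2l // ler_wpM2r ?wx_ge0 ?wx_le.
Qed.

Lemma rate_norm_le N j : `|rate N x j| <= K * (M * M).
Proof.
move: (gain_ge0 N j) (loss_ge0 N j) (gain_le N j) (loss_le N j).
by rewrite /rate ler_norml => *; apply/andP; split; lra.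
Qed.

(** These are the collisions of a size [i >= N] that leave a size [j < N]. For fixed [i] the
    partners [i - j] are distinct sizes up to [i], so their [w]-weighted sum is at most [M]; the
    remaining sum over [i] is a tail. *)
Lemma gain_tail N N' :
  w N * (\sum_(j < N) \sum_(i < N' | (N <= i)%N) a i (i - j)%N * x i * x (i - j)%N)
  <= K * (M * M).
Proof.
apply: (@le_trans _ _ (w N * \sum_(i < N' | (N <= i)%N) K * (M * (w i * x i)))).
  rewrite ler_wpM2l ?w_ge0 // exchange_big /=; apply: ler_sum => i Ni.
  apply: (@le_trans _ _ (\sum_(j < N) K * ((w i * x i) * (w (i - j)%N * x (i - j)%N)))).
    by apply: ler_sum => j _; exact: term_le.
  rewrite -!mulr_sumr ler_wpM2l // mulrC ler_wpM2r ?wx_ge0 //.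
  have := sum_w_le i.+1; apply: le_trans.
  have -> : \sum_(j < i.+1) w j * x j = \sum_(j < i.+1) w (i - j)%N * x (i - j)%N.
    rewrite (reindex_inj rev_ord_inj) /=; apply: eq_bigr => j _.
    by rewrite subSS.
  rewrite (@ord_sum_split _ N i.+1 predT (fun j => w (i - j)%N * x (i - j)%N)) ?lerDl;
    last first.
    exact: leqW.
  by apply: sumr_ge0 => j _; exact: wx_ge0.
rewrite -!mulr_sumr mulrCA ler_wpM2l // mulrCA ler_wpM2l ?mass_le_ge0 //.
exact: sum_w_tail.
Qed.

Lemma loss_tail N N' :
  w N * (\sum_(j < N) \sum_(k < N' | (N <= k)%N) a j k * x j * x k)
  <= K * (M * M).
Proof.
apply: (@le_trans _ _ (w N * \sum_(i < N' | (N <= i)%N) K * (M * (w i * x i)))).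
  rewrite ler_wpM2l ?w_ge0 // exchange_big /=; apply: ler_sum => i Ni.
  apply: (@le_trans _ _ (\sum_(j < N) K * ((w i * x i) * (w j * x j)))).
    by apply: ler_sum => j _; rewrite [X in K * X]mulrC; exact: term_le.
  by rewrite -!mulr_sumr ler_wpM2l // mulrC ler_wpM2r ?wx_ge0 // sum_w_le.
rewrite -!mulr_sumr mulrCA ler_wpM2l // mulrCA ler_wpM2l ?mass_le_ge0 //.
exact: sum_w_tail.
Qed.

(** Splitting the sums at [N] leaves the two tails above; there the constraint [j <= i] is
    automatic, since [j < N <= i]. *)
Lemma rate_tail N N' : (N <= N')%N ->
  w N * (\sum_(j < N) `|rate N' x j - rate N x j|) <= 2 * (K * (M * M)).
Proof.
move=> NN'; rewrite mulr2n mulrDl mul1r.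
apply: le_trans (lerD (gain_tail N N') (loss_tail N N')).
rewrite -mulrDr ler_wpM2l ?w_ge0 // -big_split /=; apply: ler_sum => j _.
rewrite /rate /gain /loss.
rewrite (@ord_sum_split _ N N' (fun i => (j <= i)%N) (fun i => a i (i - j)%N * x i * x (i
  - j)%N)) //.
rewrite (@ord_sum_split _ N N' predT (fun k => a j k * x j * x k)) //=.
rewrite [X in _ + X - _ - _](eq_bigl (fun i : 'I_N' => (N <= i)%N)); last first.
  by move=> i /=; apply: andb_idl => /(leq_trans (ltnW (ltn_ord j))).
set A := \sum_(i < N' | _) _; set B := \sum_(k < N' | _) _.
have A0 : 0 <= A by apply: sumr_ge0 => i _; exact: term_ge0.
have B0 : 0 <= B by apply: sumr_ge0 => i _; exact: term_ge0.
by rewrite ler_norml; apply/andP; split; lra.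
Qed.

Lemma rate_tail_coord N N' j : (N <= N')%N -> (j < N)%N ->
  w N * `|rate N' x j - rate N x j| <= 2 * (K * (M * M)).
Proof.
move=> NN' jN; apply: le_trans (rate_tail NN').
rewrite ler_wpM2l ?w_ge0 // (bigD1 (Ordinal jN)) //= lerDl.
by apply: sumr_ge0.
Qed.

(** After reindexing, the summand is [(g (i - k) - g i) * a i k * x i * x k], and [i - k <= i]. *)
Lemma rate_weighted_le0 N g : g 0%N = 0 ->
  {homo g : i j / (i <= j)%N >-> i <= j} ->
  \sum_(j < N) g j * rate N x j <= 0.
Proof.
move=> g0 gmono; rewrite /rate /gain /loss.
under eq_bigr do rewrite mulrBr.
rewrite big_split /= (@sum_difference_reindex _ N g (fun i k => a i k * x i * x k)) //
  sumrN.
rewrite subr_le0; apply: ler_sum => i _; rewrite mulr_sumr; apply: ler_sum => k _.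
by rewrite ler_wpM2r ?term_ge0 // gmono // leq_subr.
Qed.

End MassLe.

(** Each sum has at most [N] terms, with kernel at most [K * N]. The constant grows with [N], but
    [N] will be fixed before the time increment tends to 0. *)
Lemma rate_Lipschitz (M d : R) (x y : nat -> R) N j :
  mass_le M x -> mass_le M y -> 0 <= d ->
  (forall k, `|x k - y k| <= d) -> (j < N)%N ->
  `|rate N x j - rate N y j| <= 4 * (K * M * (N%:R * N%:R)) * d.
Proof.
move=> xM yM d0 xyd jN.
have M0 := mass_le_ge0 xM.
have termd i k : (i < N)%N -> (k < N)%N ->
    `|a i k * x i * x k - a i k * y i * y k| <= 2 * (K * M * N%:R) * d.
  move=> iN kN.
  (* Index 0 is separate because [x_le] bounds only positive sizes; the kernel vanishes there since
     [w 0 = 0]. *)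
  have [->|i0] := posnP i.
    have -> : a 0%N k = 0.
      by apply/eqP; rewrite eq_le a_ge0 andbT (le_trans (a_le _ _))// /w sqrtr0 mul0r
        mulr0.
    by rewrite !mul0r subrr normr0 !mulr_ge0.
  have [->|k0] := posnP k.
    have -> : a i 0%N = 0.
      by apply/eqP; rewrite eq_le a_ge0 andbT (le_trans (a_le _ _))// /w sqrtr0 !mulr0.
    by rewrite !mul0r subrr normr0 !mulr_ge0.
  have aN : a i k <= K * N%:R.
    apply: le_trans (a_le _ _) _; rewrite ler_wpM2l // -w_sqr.
    by apply: ler_pM; rewrite ?w_ge0 // w_homo // ltnW.
  have xy : `|x i * x k - y i * y k| <= 2 * M * d.
    have -> : x i * x k - y i * y k = (x i - y i) * x k + y i * (x k - y k) by ring.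
    apply: le_trans (ler_normD _ _) _; rewrite !normrM.
    have [x_ge0 _] := xM; have [y_ge0 _] := yM.
    rewrite (ger0_norm (x_ge0 k)) (ger0_norm (y_ge0 i)).
    have h1 : `|x i - y i| * x k <= d * M by apply: ler_pM => //; exact: x_le xM _ k0.
    have h2 : y i * `|x k - y k| <= M * d by apply: ler_pM => //; exact: x_le yM _ i0.
    lra.
  rewrite -!mulrA -mulrBr normrM (ger0_norm (a_ge0 _ _)).
  apply: le_trans (ler_pM _ _ aN xy) _ => //.
  by rewrite le_eqVlt; apply/orP; left; apply/eqP; ring.
have card c : \sum_(i < N) c = N%:R * c :> R.
  by rewrite sumr_const card_ord mulr_natl.
have Cge0 : 0 <= 2 * (K * M * N%:R) * d by rewrite !mulr_ge0.
have hg : `|gain N x j - gain N y j| <= N%:R * (2 * (K * M * N%:R) * d).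
  rewrite /gain -sumrB; apply: le_trans (ler_norm_sum _ _ _) _.
  rewrite -card big_mkcond /=; apply: ler_sum => i _; case: ifP => // _.
  by apply: termd => //; exact: leq_ltn_trans (leq_subr _ _) _.
have hl : `|loss N x j - loss N y j| <= N%:R * (2 * (K * M * N%:R) * d).
  rewrite /loss -sumrB; apply: le_trans (ler_norm_sum _ _ _) _.
  by rewrite -card; apply: ler_sum => i _; exact: termd.
rewrite /rate (_ : _ - _ = gain N x j - gain N y j - (loss N x j - loss N y j));
  last by ring.
apply: le_trans (ler_normB _ _) _; apply: le_trans (lerD hg hl) _.
by rewrite le_eqVlt; apply/orP; left; apply/eqP; ring.
Qed.

(* From x_j x_k - y_j y_k = ((x_j - y_j) (x_k + y_k) + (x_j + y_j) (x_k - y_k)) / 2: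
   the coefficient of the dissipative term x_j - y_j in the difference of losses. *)
Definition loss_coef (N : nat) (x y : nat -> R) (j : nat) : R :=
  2^-1 * \sum_(k < N) a j k * (x k + y k).

(** Polarization isolates the damping part of the loss. The rest is bounded through the terms
    [D i k], and the damping lowers their coefficients enough to leave at most [g k]. Then g_k
    a_{ik} <= K w_i w_k^2 = K w_i k, which turns the sum over [k] into a mass. *)
Lemma rate_difference_le M N g x y : g 0%N = 0 ->
  {homo g : i j / (i <= j)%N >-> i <= j} -> (forall k, g k <= w k) ->
  mass_le M x -> mass_le M y ->
  \sum_(j < N) g j *
    (`|rate N x j - rate N y j + loss_coef N x y j * (x j - y j)|
     - loss_coef N x y j * `|x j - y j|)
  <= 2 * (K * M) * \sum_(j < N) w j * `|x j - y j|.
Proof.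
move=> g0 gmono gw xM yM; pose lam := loss_coef N x y.
have [x_ge0 x_le] := xM; have [y_ge0 y_le] := yM.
have g_ge0 k : 0 <= g k by rewrite -g0 gmono.
pose z j := `|x j - y j|; pose s j := x j + y j.
have s_ge0 j : 0 <= s j by rewrite addr_ge0.
pose D i k := a i k * z i * s k.
have z_ge0 j : 0 <= z j by exact: normr_ge0.
have D_ge0 i k : 0 <= D i k by rewrite !mulr_ge0.
have bound j : `|rate N x j - rate N y j + lam j * (x j - y j)| <=
    2^-1 * ((\sum_(i < N | (j <= i)%N) (D i (i - j)%N + D (i - j)%N i)) +
            \sum_(k < N) D k j).
  have -> : rate N x j - rate N y j + lam j * (x j - y j) =
     2^-1 * (\sum_(i < N | (j <= i)%N) (a i (i - j)%N * (x i - y i) * s (i - j)%N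
       + a i (i - j)%N * s i * (x (i - j)%N - y (i - j)%N))
      - \sum_(k < N) a j k * s j * (x k - y k)).
    rewrite /rate /gain /loss /lam /loss_coef.
    have rearr (p q r t e : R) : p - q - (r - t) + e = (p - r) - (q - t - e) by ring.
    rewrite rearr.
    rewrite -!sumrB -mulrA mulr_suml mulrBr !mulr_sumr -sumrB; congr (_ - _).
      by apply: eq_bigr => i _; rewrite /s; field.
    by apply: eq_bigr => i _; rewrite /s; field.
  rewrite normrM ger0_norm ?invr_ge0 // ler_wpM2l ?invr_ge0 //.
  apply: le_trans (ler_normB _ _) _; apply: lerD.
    apply: le_trans (ler_norm_sum _ _ _) _; apply: ler_sum => i _.
    apply: le_trans (ler_normD _ _) _; rewrite !normrM.
    rewrite /D (ger0_norm (a_ge0 _ _)) !(ger0_norm (s_ge0 _)) -/(z _) lerD //.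
    by rewrite a_sym mulrAC.
  apply: le_trans (ler_norm_sum _ _ _) _; apply: ler_sum => k _.
  by rewrite !normrM (ger0_norm (a_ge0 _ _)) (ger0_norm (s_ge0 _)) /D a_sym mulrAC.
(* The factor [2 * M] bounds the mass of [x + y]. *)
apply: (@le_trans _ _ (\sum_(i < N) \sum_(k < N) g k * D i k)); last first.
  apply: (@le_trans _ _ (\sum_(i < N) \sum_(k < N) K * (w i * z i) * (k%:R * s k))).
    apply: ler_sum => i _; apply: ler_sum => k _.
    rewrite -w_sqr /D.
    rewrite (_ : K * _ * _ = w k * (K * (w i * w k) * z i * s k)); last by ring.
    apply: ler_pM; [exact: g_ge0 | exact: D_ge0 | exact: gw |].
    by rewrite ler_wpM2r // ler_wpM2r.
  rewrite mulr_sumr; apply: ler_sum => i _; rewrite -mulr_sumr.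
  rewrite -/(z i) (_ : 2 * (K * M) * (w i * z i) = K * (w i * z i) * (M + M));
    last by ring.
  rewrite ler_wpM2l ?mulr_ge0 ?w_ge0 //.
  under eq_bigr do rewrite mulrDr.
  by rewrite big_split; exact: lerD.
(* The four weights come from the gain, with the difference in either factor, from the loss, and
   from the damping. One of the first two is [g 0 = 0], and whichever of [i] and [k] is larger the
   total is at most [2 * g k]. *)
apply: (@le_trans _ _ (2^-1 * \sum_(i < N) \sum_(k < N)
    (g (i - k)%N + g (k - i)%N + g k - g i) * D i k)); last first.
  rewrite mulr_sumr; apply: ler_sum => i _; rewrite mulr_sumr; apply: ler_sum => k _.
  rewrite mulrA ler_wpM2r //.
  have [ki|/ltnW ik] := leqP k i.
    have -> : (k - i)%N = 0%N by apply/eqP; rewrite subn_eq0.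
    by have := gmono _ _ (leq_subr k i); have := g_ge0 k; lra.
  have -> : (i - k)%N = 0%N by apply/eqP; rewrite subn_eq0.
  by have := gmono _ _ (leq_subr i k); have := g_ge0 i; lra.
apply: (@le_trans _ _ (2^-1 * (\sum_(j < N) g j * ((\sum_(i < N | (j <= i)%N) (D i (i -
  j)%N + D (i - j)%N i)) +
            \sum_(k < N) D k j - \sum_(k < N) D j k)))).
  rewrite mulr_sumr; apply: ler_sum => j _; rewrite [leRHS]mulrCA ler_wpM2l //.
  rewrite [leRHS]mulrBr; apply: lerB; first exact: bound.
  rewrite /loss_coef -mulrA ler_wpM2l ?invr_ge0 // mulr_suml ler_sum // => k _.
  by rewrite /D mulrAC.
rewrite ler_wpM2l ?invr_ge0 //.
under eq_bigr do rewrite mulrBr mulrDr.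
have e1 : \sum_(i < N) \sum_(k < N) g (i - k)%N * D k i = \sum_(i < N) \sum_(k < N) g (k
  - i)%N * D i k.
  by rewrite exchange_big.
have e2 : \sum_(j < N) g j * (\sum_(k < N) D k j) = \sum_(i < N) \sum_(k < N) g k * D i k.
  by under eq_bigr do rewrite mulr_sumr; rewrite exchange_big.
have e3 : \sum_(j < N) g j * (\sum_(k < N) D j k) = \sum_(i < N) \sum_(k < N) g i * D i k.
  by under eq_bigr do rewrite mulr_sumr.
have e0 : \sum_(i < N) \sum_(k < N) g (i - k)%N * (D i k + D k i) =
    \sum_(i < N) \sum_(k < N) g (i - k)%N * D i k +
    \sum_(i < N) \sum_(k < N) g (k - i)%N * D i k.
  rewrite -e1 -big_split; apply: eq_bigr => i _.
  by rewrite -big_split; apply: eq_bigr => k _; rewrite mulrDr.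
rewrite sumrB big_split /=.
rewrite (@sum_difference_reindex _ N g (fun i k => D i k + D k i)) // e0 e2 e3.
rewrite -!big_split -sumrB /=; apply: ler_sum => i _.
rewrite -!big_split -sumrB /=; apply: ler_sum => k _.
by rewrite !mulrDl mulNr.
Qed.

(** * The infinite system: density and stability *)

Lemma le0_of_natr_mul_le (j : nat) (C r : R) :
  (forall n : nat, (j < n)%N -> n%:R * r <= C) -> r <= 0.
Proof.
move=> h; rewrite leNgt; apply/negP => r0.
pose n := (maxn j (Num.truncn (C / r))).+1.
have := h n (leq_ltn_trans (leq_maxl _ _) (ltnSn _)).
rewrite -ler_pdivlMr // leNgt => /negP; apply.
by apply: lt_le_trans (truncnS_gt _) _; rewrite ler_nat ltnS leq_maxr.
Qed.

Lemma w_nat_sqr n : w (n * n) = n%:R.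
Proof. by rewrite /w natrM -expr2 sqrtr_sqr ger0_norm. Qed.

(** Take N = n^2 with n > C / e and n > j: a perfect square makes [w N] equal to [n]. *)
Lemma tail_index (j : nat) (C e : R) : 0 < e ->
  exists N, (j < N)%N /\ forall r, w N * r <= C -> r <= e.
Proof.
move=> e0; pose n := (maxn j (Num.truncn (C / e))).+1.
exists (n * n)%N; split.
  by apply: leq_trans (leq_pmulr _ _) => //; rewrite ltnS leq_maxl.
move=> r; rewrite w_nat_sqr => nr; rewrite leNgt; apply/negP => er.
have : C / e < n%:R.
  by apply: lt_le_trans (truncnS_gt _) _; rewrite ler_nat ltnS leq_maxr.
rewrite ltr_pdivrMr // ltNge => /negP; apply; apply: le_trans nr.
by rewrite ler_pM2l ?ltr0n // ltW.
Qed.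

Definition gain_lim (x : nat -> R) (j : nat) : R := limn (fun N => gain N x j).
Definition loss_lim (x : nat -> R) (j : nat) : R := limn (fun N => loss N x j).
Definition rate_lim (x : nat -> R) (j : nat) : R := gain_lim x j - loss_lim x j.

(** * Passage to the limit in the truncation *)

Section Limits.
Variables (M : R) (x : nat -> R).
Hypothesis xM : mass_le M x.

Lemma gain_cvg j : gain N x j @[N --> \oo] --> gain_lim x j.
Proof.
apply: nondecreasing_is_cvgn.
  move=> p q pq; rewrite /gain.
  rewrite (@ord_sum_split _ p q (fun i => (j <= i)%N) (fun i => a i (i - j)%N * x i * x
    (i - j)%N)) //.
  by rewrite lerDl sumr_ge0 // => i _; exact: (term_ge0 xM).
by exists (K * (M * M)) => _ [N _ <-]; exact: (gain_le xM).
Qed.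

Lemma loss_cvg j : loss N x j @[N --> \oo] --> loss_lim x j.
Proof.
apply: nondecreasing_is_cvgn.
  move=> p q pq; rewrite /loss.
  rewrite (@ord_sum_split _ p q predT (fun k => a j k * x j * x k)) //.
  by rewrite lerDl sumr_ge0 // => i _; exact: (term_ge0 xM).
by exists (K * (M * M)) => _ [N _ <-]; exact: (loss_le xM).
Qed.

Lemma rate_cvg j : rate N x j @[N --> \oo] --> rate_lim x j.
Proof. by apply: cvgB; [exact: gain_cvg | exact: loss_cvg]. Qed.

Lemma rate_lim_tail N :
  w N * (\sum_(j < N) `|rate_lim x j - rate N x j|) <= 2 * (K * (M * M)).
Proof.
have cv : w N * (\sum_(j < N) `|rate N' x j - rate N x j|) @[N' --> \oo] -->
   w N * (\sum_(j < N) `|rate_lim x j - rate N x j|).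
  apply: cvgM; first exact: cvg_cst.
  apply: cvg_big => [|i _]; first exact: add_continuous.
  apply: cvg_norm; apply: cvgB; [exact: rate_cvg | exact: cvg_cst].
rewrite -(cvg_lim _ cv) //; apply: limr_le; first exact: cvgP cv.
by exists N => // N' /= NN'; exact: (rate_tail xM).
Qed.

Lemma rate_lim_tail_coord N j : (j < N)%N ->
  w N * `|rate_lim x j - rate N x j| <= 2 * (K * (M * M)).
Proof.
move=> jN; apply: le_trans (rate_lim_tail N).
rewrite ler_wpM2l ?w_ge0 // (bigD1 (Ordinal jN)) //= lerDl.
by apply: sumr_ge0.
Qed.

End Limits.

Lemma rate_continuous A (c : R -> nat -> R) N j :
  (forall k, {within A, continuous (fun t => c t k)}) ->
  {within A, continuous (fun t => rate N (c t) j)}.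
Proof.
move=> cc x; apply: cvgB; (apply: cvg_big => [|i _]; first exact: add_continuous);
  by apply: cvgM; [apply: cvgM; [exact: cvg_cst|exact: cc] | exact: cc].
Qed.

(** The truncated rates are continuous in time and, under a common mass bound, converge uniformly to
    [rate_lim]. *)
Lemma rate_lim_continuous M A (c : R -> nat -> R) j :
  (forall t, A t -> mass_le M (c t)) ->
  (forall k, {within A, continuous (fun t => c t k)}) ->
  {within A, continuous (fun t => rate_lim (c t) j)}.
Proof.
move=> cM cc; apply/within_continuous_epsP => x Ax e e0.
have e30 : 0 < e / 3 by rewrite divr_gt0.
have [N [jN NP]] := tail_index j (2 * (K * (M * M))) e30.
have /within_continuous_epsP/(_ _ Ax _ e30)[d d0 dP] := @rate_continuous A c N j cc.
exists d => // z Az zx.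
have := dP _ Az zx.
have := NP _ (rate_lim_tail_coord (cM _ Ax) jN).
have := NP _ (rate_lim_tail_coord (cM _ Az) jN).
rewrite ltr_norml ler_norml ler_norml => /andP[? ?] /andP[? ?] /andP[? ?].
by rewrite ltr_norml; apply/andP; split; lra.
Qed.

(* Size 0 is excluded from the differential equation: [clear0] below puts it to 0. *)
Definition trajectory (M a0 b : R) (c : R -> nat -> R) : Prop :=
  [/\ forall t, a0 <= t -> t <= b -> mass_le M (c t),
      forall j, {within `[a0, b], continuous (fun t => c t j)}
    & forall j s, (0 < j)%N -> a0 <= s -> s < b ->
        right_deriv (fun t => c t j) s (rate_lim (c s) j)].

Lemma trajectory_widen M M' a0 b c : M <= M' ->
  trajectory M a0 b c -> trajectory M' a0 b c.
Proof.
move=> MM' [cM cc dc]; split=> // t ta tb; have [c_ge0 c_le] := cM _ ta tb.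
by split=> // N; exact: le_trans (c_le N) MM'.
Qed.

(** The truncated rate contributes a nonpositive slope, and its distance to [rate_lim] at most [m]
    times the tail bound. Gronwall's lemma is used with [C = 0]. *)
Lemma weighted_mass_le M a0 b c N (m : R) g : a0 <= b -> trajectory M a0 b c ->
  (0 < N)%N -> g 0%N = 0 -> {homo g : i j / (i <= j)%N >-> i <= j} ->
  (forall k, g k <= m) ->
  \sum_(j < N) g j * c b j <=
  \sum_(j < N) g j * c a0 j + m * (2 * (K * (M * M))) / w N * (b - a0).
Proof.
move=> ab [cM cc dc] N0 g0 gmono gm.
have g_ge0 k : 0 <= g k by rewrite -g0 gmono.
have m0 : 0 <= m by rewrite -g0.
have wN0 : 0 < w N by rewrite (lt_le_trans ltr01) // w_ge1.
set D := m * _ / w N.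
have D0 : 0 <= D.
  rewrite divr_ge0 ?w_ge0 // mulr_ge0 // mulr_ge0 // mulr_ge0 //.
  by rewrite mulr_ge0 // (mass_le_ge0 (cM _ (lexx a0) ab)).
have := @Gronwall_right_slope R (fun t => \sum_(j < N) g j * c t j) a0 b 0 D ab (lexx _)
  D0.
rewrite mul0r expR0 mul1r; apply.
- move=> x; apply: cvg_big => [|i _]; first exact: add_continuous.
  by apply: cvgM; [exact: cvg_cst | exact: cc].
- move=> s sa sb; apply: sumr_ge0 => j _; rewrite mulr_ge0 //.
  by have [] := cM _ sa sb.
move=> s sa sb; rewrite mul0r add0r.
have sM := cM _ sa (ltW sb).
apply: (@right_slope_le_trans _ _ _ (\sum_(j < N) g j * rate_lim (c s) j)); last first.
  apply: right_slope_le_sum => j.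
  have [->|j0] := posnP j; first by rewrite g0; exact: right_slope_le_mul0.
  by apply: right_slope_leZ => //; apply: right_deriv_slope; exact: dc.
have : \sum_(j < N) g j * (rate_lim (c s) j - rate N (c s) j) <= D.
  rewrite /D -mulrA; apply: (@le_trans _ _ (m * \sum_(j < N) `|rate_lim (c s) j - rate N
    (c s) j|)).
    rewrite mulr_sumr; apply: ler_sum => j _.
    apply: (@le_trans _ _ (g j * `|rate_lim (c s) j - rate N (c s) j|)).
      by rewrite ler_wpM2l // ler_norm.
    by rewrite ler_wpM2r.
  by rewrite ler_wpM2l // ler_pdivlMr // mulrC; exact: (rate_lim_tail sM).
have := rate_weighted_le0 sM N g0 gmono.
under [X in _ -> X <= _ -> _]eq_bigr do rewrite mulrBr.
rewrite sumrB; lra.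
Qed.

(** The weight min(k, n) equals k on the sizes summed in the conclusion. Its truncation error is of
    order n / w_N, which becomes arbitrarily small as [N] grows with [n] fixed. *)
Lemma mass_nonincreasing M a0 b c n (B : R) : a0 <= b -> trajectory M a0 b c ->
  (forall N, \sum_(j < N) j%:R * c a0 j <= B) ->
  \sum_(j < n) j%:R * c b j <= B.
Proof.
move=> ab cT cB; have [cM cc dc] := cT.
pose g (k : nat) : R := (minn k n)%:R.
have cb0 : forall j, 0 <= c b j by have [] := cM _ ab (lexx b).
have ca0 : forall j, 0 <= c a0 j by have [] := cM _ (lexx a0) ab.
set S := \sum_(j < n) _; apply/ler_addgt0Pr => e e0.
have [N [nN NP]] := tail_index n (n%:R * (2 * (K * (M * M))) * (b - a0)) e0.
have N0 : (0 < N)%N by exact: leq_ltn_trans nN.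
have wN0 : 0 < w N by rewrite (lt_le_trans ltr01) // w_ge1.
have := @weighted_mass_le M a0 b c N n%:R g ab cT N0.
rewrite {1}/g min0n => /(_ erefl) h.
have {}h : \sum_(j < N) g j * c b j <=
  \sum_(j < N) g j * c a0 j + n%:R * (2 * (K * (M * M))) / w N * (b - a0).
  apply: h => [i j ij|k]; last by rewrite ler_nat geq_minr.
  by rewrite ler_nat leq_min geq_minr andbT (leq_trans _ ij) // geq_minl.
have h1 : S <= \sum_(j < N) g j * c b j.
  rewrite (@ord_sum_split _ n N predT (fun j => g j * c b j)) ?(ltnW nN) //.
  rewrite ler_wpDr //; first by apply: sumr_ge0 => j _; rewrite mulr_ge0.
  apply: ler_sum => j _; rewrite /g (minn_idPl _) //; exact: ltnW.
have h2 : \sum_(j < N) g j * c a0 j <= B.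
  apply: le_trans (cB N); apply: ler_sum => j _.
  by rewrite ler_wpM2r // ler_nat geq_minl.
have h3 : n%:R * (2 * (K * (M * M))) / w N * (b - a0) <= e.
  by apply: NP; rewrite [X in _ * X]mulrAC mulrCA divff ?gt_eqF // mulr1.
lra.
Qed.

Definition capped_dist (N : nat) (m : R) (x y : nat -> R) : R :=
  \sum_(j < N) Num.min (w j) m * `|x j - y j|.

Section Stability.
Variables (M b : R) (c d : R -> nat -> R).
Hypotheses (b0 : 0 <= b) (cT : trajectory M 0 b c) (dT : trajectory M 0 b d).

(** Gronwall's lemma applies with two source terms: the cost of replacing [w] by its cap, and the
    truncation errors of both trajectories, weighted by at most [m]. *)
Lemma capped_dist_le (N : nat) (m : R) : (0 < N)%N -> 0 < m ->
  capped_dist N m (c b) (d b) <=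
  expR (2 * (K * M) * b) * (capped_dist N m (c 0) (d 0) +
    (2 * (K * M) * (2 * M / m) + m * (4 * (K * (M * M))) / w N) * b).
Proof.
move=> N0 m0; pose g k := Num.min (w k) m.
pose y t := capped_dist N m (c t) (d t).
set D := 2 * (K * M) * (2 * M / m) + _.
have [cM cc dc] := cT; have [dM cd dd] := dT.
have M0 := mass_le_ge0 (cM _ (lexx 0) b0).
have wN0 : 0 < w N by rewrite (lt_le_trans ltr01) // w_ge1.
have g0 : g 0%N = 0 by rewrite /g /w sqrtr0 min_l // ltW.
have gmono : {homo g : i j / (i <= j)%N >-> i <= j}.
  by move=> i j ij; rewrite /g le_min !ge_min w_homo // lexx orbT.
have gw k : g k <= w k by rewrite /g ge_min lexx.
have gm k : g k <= m by rewrite /g ge_min lexx orbT.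
have g_ge0 k : 0 <= g k by rewrite -g0 gmono.
have KM0 : 0 <= 2 * (K * M) by rewrite !mulr_ge0.
have D0 : 0 <= D.
  have m0' := ltW m0.
  by rewrite addr_ge0 // ?divr_ge0 ?w_ge0 // mulr_ge0 // ?divr_ge0 // mulr_ge0 //
    mulr_ge0 // mulr_ge0.
have := @Gronwall_right_slope R y 0 b (2 * (K * M)) D b0 KM0 D0.
rewrite subr0; apply.
- move=> x; apply: cvg_big => [|i _]; first exact: add_continuous.
  apply: cvgM; first exact: cvg_cst.
  by apply: cvg_norm; apply: cvgB; [exact: cc | exact: cd].
- by move=> s _ _; apply: sumr_ge0 => j _; rewrite mulr_ge0 //; exact: g_ge0.
move=> s s0 sb.
have cMs := cM _ s0 (ltW sb); have dMs := dM _ s0 (ltW sb).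
pose lam := loss_coef N (c s) (d s).
have lam0 j : 0 <= lam j.
  rewrite /lam /loss_coef mulr_ge0 ?invr_ge0 //; apply: sumr_ge0 => k _.
  have [x0 _] := cMs; have [y0 _] := dMs.
  by rewrite mulr_ge0 // addr_ge0.
pose z j := c s j - d s j.
(* The damping estimate concerns truncated rates, so their distance to [rate_lim] is kept apart in
   [tail]. *)
pose tail j := `|rate_lim (c s) j - rate N (c s) j| + `|rate_lim (d s) j - rate N (d s)
  j|.
pose damped j := `|rate N (c s) j - rate N (d s) j + lam j * z j| - lam j * `|z j|.
suff : right_slope_le (fun t => \sum_(j < N) g j * `|c t j - d t j|) s
  (2 * (K * M) * y s + D) by [].
apply: (@right_slope_le_trans _ _ _ (\sum_(j < N) g j * (damped j + tail j))); last first.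
  apply: right_slope_le_sum => j.
  have [->|j0] := posnP j; first by rewrite g0; exact: right_slope_le_mul0.
  apply: right_slope_leZ => //; apply: right_slope_le_trans; last first.
    apply: (right_slope_le_norm (lam0 j)).
    by apply: right_derivB; [exact: dc | exact: dd].
  rewrite /damped /tail [leRHS]addrAC lerD2r.
  set A := rate N (c s) j; set A' := rate N (d s) j.
  set B := rate_lim (c s) j; set B' := rate_lim (d s) j.
  rewrite (_ : B - B' + _ = (A - A' + lam j * z j) + (B - A) - (B' - A'));
    last by rewrite /z; ring.
  apply: le_trans (ler_normB _ _) _; rewrite [leRHS]addrA lerD2r.
  exact: ler_normD.
under eq_bigr do rewrite mulrDr.
rewrite big_split /=.
have h1 := @rate_difference_le M N g (c s) (d s) g0 gmono gw cMs dMs.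
(* Where w_j > m, one has w_j <= w_j^2 / m = j / m, so the part above the cap costs at most 1 / m
   times the two masses. *)
have h2 : \sum_(j < N) w j * `|z j| <= y s + 2 * M / m.
  apply: (@le_trans _ _ (\sum_(j < N) (g j * `|z j| + m^-1 * (j%:R * c s j + j%:R * d s
    j)))).
    apply: ler_sum => j _.
    apply: (@le_trans _ _ (g j * `|z j| + m^-1 * (j%:R * `|z j|))); last first.
      rewrite lerD2l ler_pM2l ?invr_gt0 // -mulrDr ler_wpM2l //.
      apply: le_trans (ler_normB _ _) _.
      by have [x0 _] := cMs; have [y0 _] := dMs; rewrite !ger0_norm.
    rewrite mulrA -mulrDl ler_wpM2r // /g.
    have [wm|mw] := leP (w j) m; first by rewrite lerDl mulr_ge0 ?invr_ge0 // ltW.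
    rewrite ler_wpDl ?(ltW m0) // -w_sqr [leRHS]mulrC ler_pdivlMr //.
    by rewrite ler_wpM2l ?w_ge0 // ltW.
  rewrite big_split /= lerD2l -mulr_sumr big_split /= [leRHS]mulrC.
  rewrite ler_pM2l ?invr_gt0 // mulr2n mulrDl mul1r.
  by have [_ x1] := cMs; have [_ y1] := dMs; exact: lerD (x1 N) (y1 N).
have h3 : \sum_(j < N) g j * tail j <= m * (4 * (K * (M * M))) / w N.
  rewrite -mulrA; apply: (@le_trans _ _ (m * \sum_(j < N) tail j)).
    rewrite mulr_sumr; apply: ler_sum => j _.
    by rewrite ler_wpM2r // addr_ge0.
  rewrite ler_pM2l // ler_pdivlMr // mulrC big_split mulrDr.
  have := lerD (rate_lim_tail cMs N) (rate_lim_tail dMs N).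
  move=> /le_trans; apply; rewrite le_eqVlt; apply/orP; left; apply/eqP; ring.
have h4 := ler_wpM2l KM0 h2.
apply: le_trans (lerD (le_trans h1 h4) h3) _.
by rewrite /D le_eqVlt; apply/orP; left; apply/eqP; ring.
Qed.

Lemma trajectory_unique j : (forall k, (0 < k)%N -> c 0 k = d 0 k) -> (0 < j)%N -> c b j
  = d b j.
Proof.
move=> c0d0 j0; apply/eqP; rewrite -subr_eq0 -normr_le0.
have [cM cc dc] := cT.
have M0 := mass_le_ge0 (cM _ (lexx 0) b0).
apply: (@le0_of_natr_mul_le j (expR (2 * (K * M) * b) * (8 * (K * (M * M)) * b))) => n jn.
have n0 : (0 < n)%N by exact: leq_ltn_trans jn.
have nR0 : 0 < n%:R :> R by rewrite ltr0n.
(* Then [w N = n * n], and the truncation error is of order 1 / n, like the cap error; each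
   contributes 4 to the constant 8. *)
pose N := ((n * n) * (n * n))%N.
have N0 : (0 < N)%N by rewrite !muln_gt0 n0.
have jN : (j < N)%N.
  by apply: leq_trans jn _; rewrite /N -mulnA leq_pmulr // !muln_gt0 n0.
have := @capped_dist_le N n%:R N0 nR0.
rewrite /capped_dist.
rewrite [X in _ * (X + _)]big1 ?add0r; last first.
  move=> i _; have [->|i0] := posnP i.
    by rewrite /w sqrtr0 min_l ?mul0r // ltW.
  by rewrite c0d0 // subrr normr0 mulr0.
rewrite w_nat_sqr natrM (bigD1 (Ordinal jN)) //=.
set S := \sum_(i < N | _) _ => h.
have S0 : 0 <= S.
  by apply: sumr_ge0 => i _; rewrite mulr_ge0 // le_min w_ge0 ler0n.
have h1 : `|c b j - d b j| <= Num.min (w j) n%:R * `|c b j - d b j|.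
  by rewrite ler_peMl // le_min w_ge1 // ler1n.
have h2 : `|c b j - d b j| <= expR (2 * (K * M) * b) *
    ((2 * (K * M) * (2 * M / n%:R) + n%:R * (4 * (K * (M * M))) / (n%:R * n%:R)) * b).
  by apply: le_trans h1 (le_trans _ h); rewrite lerDl.
apply: le_trans (ler_wpM2l (ltW nR0) h2) _.
rewrite le_eqVlt; apply/orP; left; apply/eqP; field.
by rewrite gt_eqF.
Qed.

End Stability.

(** * Existence by Euler schemes *)

Section Euler.
Variables (M : R) (x0 : nat -> R).
Hypothesis x0M : mass_le M x0.

Let M_ge0 : 0 <= M := mass_le_ge0 x0M.

(* Small enough for an Euler step of the system truncated at [n] to preserve
   positivity: the loss rate per cluster is at most [n K M]. *)
Definition mesh (n : nat) : R := (n.+1%:R * (1 + K * M))^-1.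

(** Cutting the datum at [n] keeps all iterates supported below [n], where the truncated system is
    closed. *)
Definition euler (n l : nat) : nat -> R :=
  iter l (fun x j => x j + mesh n * rate n x j)
    (fun j => if (j < n)%N then x0 j else 0).

Lemma eulerS n l j :
  euler n l.+1 j = euler n l j + mesh n * rate n (euler n l) j.
Proof. by []. Qed.

Lemma mesh_den_gt0 : 0 < 1 + K * M.
Proof. by rewrite ltr_pwDl // mulr_ge0. Qed.

Lemma mesh_gt0 n : 0 < mesh n.
Proof. by rewrite invr_gt0 mulr_gt0 // mesh_den_gt0. Qed.

Lemma mesh_cvg0 : mesh n @[n --> \oo] --> 0.
Proof.
apply: (@squeeze_cvgr _ _ _ _ (cst 0) (fun n : nat => n.+1%:R^-1)).
- near=> n; rewrite (ltW (mesh_gt0 n)) /= /mesh invfM ler_piMr ?invr_ge0 //.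
  by rewrite invf_le1 ?mesh_den_gt0 // lerDl mulr_ge0.
- exact: cvg_cst.
- exact: cvg_harmonic.
Unshelve. all: by end_near. Qed.

Lemma mass_le_finite_support n (x : nat -> R) : (forall j, 0 <= x j) ->
  (forall j, (n <= j)%N -> x j = 0) -> \sum_(j < n) j%:R * x j <= M -> mass_le M x.
Proof.
move=> x_ge0 xn xM; split=> // N; apply: le_trans xM.
have [Nn|/ltnW nN] := leqP N n.
  rewrite (@ord_sum_split _ N n predT (fun j => j%:R * x j)) // lerDl.
  by apply: sumr_ge0 => j _; rewrite mulr_ge0.
rewrite (@ord_sum_split _ n N predT (fun j => j%:R * x j)) // [X in _ + X]big1 ?addr0 //.
by move=> j /= nj; rewrite xn // mulr0.
Qed.

(** Mass and support go through the induction together: the mass bound limits the loss in the next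
    step, so that [mesh] preserves positivity, and the support reduces the mass to a sum below
    [n]. *)
Lemma euler_invariant n l :
  mass_le M (euler n l) /\ forall j, (n <= j)%N -> euler n l j = 0.
Proof.
elim: l => [|l [xM xn]]; first have [x0_ge0 x0_le] := x0M.
  have supp j : (n <= j)%N -> euler n 0 j = 0.
    by rewrite /euler /= ltnNge => ->.
  split=> //; apply: (@mass_le_finite_support n) => //.
    by move=> j; rewrite /euler /=; case: ifP.
  apply: le_trans (x0_le n); apply: ler_sum => j _.
  by rewrite /euler /= ltn_ord.
have [x_ge0 x_le] := xM.
have supp j : (n <= j)%N -> euler n l.+1 j = 0.
  move=> nj; rewrite eulerS xn // /rate /gain /loss big_pred0; last first.
    by move=> i; apply/negbTE; rewrite -ltnNge (leq_trans (ltn_ord i)).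
  by rewrite big1 ?subr0 ?mulr0 ?addr0 // => i _; rewrite xn // mulr0 mul0r.
split=> //; apply: (@mass_le_finite_support n) => //.
  move=> j; have [jn|/supp -> //] := ltnP j n.
  rewrite eulerS /rate mulrBr.
  have h1 : 0 <= mesh n * gain n (euler n l) j.
    by rewrite mulr_ge0 ?(gain_ge0 xM) // ltW // mesh_gt0.
  suff : mesh n * loss n (euler n l) j <= euler n l j by lra.
  rewrite ler_pdivrMl; last by rewrite mulr_gt0 // mesh_den_gt0.
  apply: (@le_trans _ _ (\sum_(k < n) (K * (w j * euler n l j)) * (w k * euler n l k))).
    by apply: ler_sum => k _; rewrite -[leRHS]mulrA; exact: (term_le xM).
  rewrite -mulr_sumr.
  apply: (@le_trans _ _ (K * (n%:R * euler n l j) * M)).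
    apply: ler_pM; rewrite ?mulr_ge0 ?w_ge0 //.
    - by apply: sumr_ge0 => k _; rewrite mulr_ge0 ?w_ge0.
    - rewrite ler_wpM2l // ler_wpM2r // (le_trans (w_le j)) // ler_nat ltnW //.
    - exact: (sum_w_le xM).
  rewrite (_ : K * _ * M = n%:R * (K * M) * euler n l j); last by ring.
  rewrite ler_wpM2r //; apply: ler_pM => //; first by rewrite mulr_ge0.
    by rewrite ler_nat.
  by rewrite lerDr.
(* The mass does not grow, by [rate_weighted_le0] with the weight g_j = j. *)
under eq_bigr do rewrite eulerS mulrDr mulrCA.
rewrite big_split /= -mulr_sumr.
have := x_le n.
have : mesh n * (\sum_(j < n) j%:R * rate n (euler n l) j) <= 0.
  rewrite mulr_ge0_le0 //; first exact/ltW/mesh_gt0.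
  by apply: (rate_weighted_le0 xM n) => // i j ij; rewrite ler_nat.
lra.
Qed.

Lemma euler_mass_le n l : mass_le M (euler n l).
Proof. by have [] := euler_invariant n l. Qed.

Lemma euler_Lipschitz n l q k :
  `|euler n (l + q) k - euler n l k| <= q%:R * mesh n * (K * (M * M)).
Proof.
elim: q => [|q IH]; first by rewrite addn0 subrr normr0 !mul0r.
have -> : euler n (l + q.+1) k - euler n l k =
  euler n (l + q) k - euler n l k + mesh n * rate n (euler n (l + q)) k.
  by rewrite addnS eulerS addrAC.
apply: le_trans (ler_normD _ _) _.
rewrite -natr1 !mulrDl mul1r lerD // normrM gtr0_norm ?mesh_gt0 //.
by rewrite ler_pM2l ?mesh_gt0 //; exact: (rate_norm_le (euler_mass_le _ _)).
Qed.

(** In a time [t] the state moves by at most t K M^2, which the Lipschitz constant of the truncated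
    rate multiplies; the last term is the cost of truncating at [N]. *)
Definition slope_error (N : nat) (t : R) : R :=
  4 * (K * M * (N%:R * N%:R)) * (t * (K * (M * M))) + 2 * (K * (M * M)) / w N.

(** The rate is frozen at step [l] and truncated at a fixed [N], so the bound depends on [n] only
    through the elapsed time [p%:R * mesh n]. *)
Lemma euler_slope n l p N j : (j < N)%N -> (N <= n)%N ->
  `|euler n (l + p) j - euler n l j - p%:R * mesh n * rate N (euler n l) j|
  <= p%:R * mesh n * slope_error N (p%:R * mesh n).
Proof.
move=> jN Nn; have h0 := mesh_gt0 n.
have wN0 : 0 < w N by rewrite (lt_le_trans ltr01) // w_ge1 // (leq_trans _ jN).
suff H q : (q <= p)%N ->
    `|euler n (l + q) j - euler n l j - q%:R * mesh n * rate N (euler n l) j|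
    <= q%:R * mesh n * slope_error N (p%:R * mesh n) by exact: H.
elim: q => [|q IH] qp; first by rewrite addn0 subrr !mul0r subrr normr0.
have -> : euler n (l + q.+1) j - euler n l j - q.+1%:R * mesh n * rate N (euler n l) j =
  (euler n (l + q) j - euler n l j - q%:R * mesh n * rate N (euler n l) j) +
  mesh n * ((rate N (euler n (l + q)) j - rate N (euler n l) j) +
    (rate n (euler n (l + q)) j - rate N (euler n (l + q)) j)).
  by rewrite addnS eulerS -natr1; ring.
apply: le_trans (ler_normD _ _) _.
rewrite -natr1 !mulrDl mul1r; apply: lerD; first exact: IH (ltnW qp).
rewrite normrM gtr0_norm // ler_pM2l //; apply: le_trans (ler_normD _ _) _.
apply: lerD; last first.
  by rewrite ler_pdivlMr // mulrC; exact: (rate_tail_coord (euler_mass_le _ _)).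
apply: (rate_Lipschitz (euler_mass_le _ _) (euler_mass_le _ _)) => //.
  by rewrite !mulr_ge0 // ltW.
move=> k; apply: le_trans (euler_Lipschitz _ _ _ _) _.
by rewrite ler_wpM2r ?mulr_ge0 // ler_pM2r // ler_nat ltnW.
Qed.

Definition euler_time (n : nat) (t : R) : nat := Num.truncn (t / mesh n).

Lemma euler_time_cvg t : 0 <= t ->
  (euler_time n t)%:R * mesh n @[n --> \oo] --> t.
Proof.
move=> t0.
have b n : t - mesh n <= (euler_time n t)%:R * mesh n <= t.
  have h0 := mesh_gt0 n.
  have /truncn_itv/andP[h1 h2] : 0 <= t / mesh n by rewrite divr_ge0 // ltW.
  rewrite -ler_pdivlMr // h1 andbT.
  by move: h2; rewrite ltr_pdivrMr // -natr1 mulrDl mul1r => /ltW; rewrite lerBlDr.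
apply: (@squeeze_cvgr _ _ _ _ (fun n => t - mesh n) (cst t)).
- by near=> n.
- by rewrite -[X in _ --> X]subr0; apply: cvgB; [exact: cvg_cst | exact: mesh_cvg0].
- exact: cvg_cst.
Unshelve. all: by end_near. Qed.

Lemma euler_time_le n t : 0 <= t -> (euler_time n t)%:R * mesh n <= t.
Proof.
move=> t0; have h0 := mesh_gt0 n.
have /truncn_itv/andP[h1 h2] : 0 <= t / mesh n by rewrite divr_ge0 // ltW.
by rewrite -ler_pdivlMr.
Qed.

Lemma euler_time_homo n s t : s <= t -> (euler_time n s <= euler_time n t)%N.
Proof. by move=> st; apply: le_truncn; rewrite ler_pM2r // invr_gt0 mesh_gt0. Qed.

Lemma trajectory_exists : exists u : R -> nat -> R,
  (forall j, u 0 j = x0 j) /\ forall b, 0 <= b -> trajectory M 0 b u.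
Proof.
(* [G] refines the filter of neighbourhoods of infinity, so ordinary limits in [n] remain limits
   along [G]. *)
have [G [GU Goo]] := ultraFilterLemma (@eventually_filter).
have GP : ProperFilter G by exact: ultra_proper.
pose v n t j := euler n (euler_time n t) j.
pose u t j := lim ((fun n => v n t j) @ G).
have toG (f : nat -> R) l : f n @[n --> \oo] --> l -> f @ G --> l.
  by move=> fl A nA; apply: Goo; exact: fl.
have vu t j : 0 <= t -> (fun n => v n t j) @ G --> u t j.
  move=> t0; apply: (@bounded_ultra_cvg R G _ (x0 j + t * (K * (M * M)))) => // n.
  have := euler_Lipschitz n 0 (euler_time n t) j; rewrite add0n => h.
  rewrite (_ : v n t j = (v n t j - euler n 0 j) + euler n 0 j); last by rewrite subrK.
  apply: le_trans (ler_normD _ _) _; rewrite addrC lerD //.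
    have [x0_ge0 _] := x0M; rewrite /euler /=; case: ifP => _; last by rewrite normr0.
    by rewrite ger0_norm.
  by apply: le_trans h _; rewrite ler_wpM2r ?mulr_ge0 // euler_time_le.
have uM t : 0 <= t -> mass_le M (u t).
  move=> t0; split=> [j|N].
    apply: (@ler_cvg_to _ G _ _ (cst 0) (fun n => v n t j)); [exact: cvg_cst|exact: vu|].
    by near=> n; have [h _] := euler_mass_le n (euler_time n t); exact: h.
  apply: (@ler_cvg_to _ G _ _ (fun n => \sum_(j < N) j%:R * v n t j) (cst M));
    last 2 first.
  - exact: cvg_cst.
  - by near=> n; have [_ h] := euler_mass_le n (euler_time n t); exact: h.
  apply: cvg_big => [|i _]; first exact: add_continuous.
  by apply: cvgM; [exact: cvg_cst | exact: vu].
have span_cvg s t : 0 <= s -> s <= t ->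
    (fun n => (euler_time n t - euler_time n s)%N%:R * mesh n) @ G --> t - s.
  move=> s0 st; apply: toG.
  rewrite (_ : (fun n => _) = (fun n => (euler_time n t)%:R * mesh n - (euler_time n
    s)%:R * mesh n)).
    by apply: cvgB; apply: euler_time_cvg; rewrite // (le_trans s0).
  by apply/funext => n; rewrite natrB ?euler_time_homo // mulrBl.
have u_Lip s t j : 0 <= s -> s <= t -> `|u t j - u s j| <= (t - s) * (K * (M * M)).
  move=> s0 st; have t0 := le_trans s0 st.
  apply: (@ler_cvg_to _ G _ _ (fun n => `|v n t j - v n s j|)
    (fun n => (euler_time n t - euler_time n s)%N%:R * mesh n * (K * (M * M)))).
  - by apply: cvg_norm; apply: cvgB; exact: vu.
  - by apply: cvgM; [exact: span_cvg | exact: cvg_cst].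
  near=> n; have := euler_Lipschitz n (euler_time n s) (euler_time n t - euler_time n s)
    j.
  by rewrite subnKC ?euler_time_homo.
(* Only the finitely many sizes below [N] enter [rate N], so pointwise convergence carries
   [euler_slope] to the limit. *)
have u_slope N s t j : (j < N)%N -> 0 <= s -> s <= t ->
    `|u t j - u s j - (t - s) * rate N (u s) j| <= (t - s) * slope_error N (t - s).
  move=> jN s0 st; have t0 := le_trans s0 st.
  apply: (@ler_cvg_to _ G _ _
    (fun n => `|v n t j - v n s j -
       (euler_time n t - euler_time n s)%N%:R * mesh n * rate N (v n s) j|)
    (fun n => (euler_time n t - euler_time n s)%N%:R * mesh n *
       slope_error N ((euler_time n t - euler_time n s)%N%:R * mesh n))).
  - apply: cvg_norm; apply: cvgB; first by apply: cvgB; exact: vu.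
    apply: cvgM; first exact: span_cvg.
    apply: cvgB; (apply: cvg_big => [|i _]; first exact: add_continuous);
      by apply: cvgM; [apply: cvgM; [exact: cvg_cst|exact: vu] | exact: vu].
  - apply: cvgM; first exact: span_cvg.
    apply: cvgD; last exact: cvg_cst.
    apply: cvgM; first exact: cvg_cst.
    by apply: cvgM; [exact: span_cvg | exact: cvg_cst].
  have : G [set n | (N <= n)%N] by apply: Goo; exists N.
  apply: filterS => n /= Nn.
  have := @euler_slope n (euler_time n s) (euler_time n t - euler_time n s) N j jN Nn.
  by rewrite subnKC ?euler_time_homo.
exists u; split=> [j|b b0].
  apply: cvg_lim => //; apply: toG.
  apply: cvg_near_cst; exists j.+1 => // n /= jn.
  by rewrite /v /euler_time mul0r truncn0 /euler /= jn.
split=> [t t0 _|j|j s j0 s0 sb]; first exact: uM.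
  apply/within_continuous_epsP => x; rewrite /= in_itv /= => /andP[x0' xb] e e0.
  have C0 : 0 < K * (M * M) + 1 by rewrite ltr_wpDl // !mulr_ge0.
  exists (e / (K * (M * M) + 1)); first by rewrite divr_gt0.
  have sym y z : 0 <= y -> 0 <= z -> `|u z j - u y j| <= `|z - y| * (K * (M * M)).
    move=> y0 z0; have [yz|/ltW zy] := leP y z.
      by rewrite (ger0_norm (_ : 0 <= z - y)) ?subr_ge0 // u_Lip.
    by rewrite distrC [`|z - y|]distrC (ger0_norm (_ : 0 <= y - z)) ?subr_ge0 // u_Lip.
  move=> z; rewrite /= in_itv /= => /andP[z0 zb]; rewrite ltr_pdivlMr // => zx.
  apply: le_lt_trans (sym _ _ x0' z0) (le_lt_trans _ zx).
  by rewrite ler_wpM2l // lerDl.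
(* [N] is chosen first: it makes the truncation error at most e / 3 twice, in [slope_error] and
   between [rate N] and [rate_lim]. Then [h] is taken small enough for the Lipschitz part. *)
move=> e e0; have e30 : 0 < e / 3 by rewrite divr_gt0.
have [N [jN NP]] := tail_index j (2 * (K * (M * M))) e30.
have wN0 : 0 < w N by rewrite (lt_le_trans ltr01) // w_ge1 // (leq_trans _ jN).
pose L := 4 * (K * M * (N%:R * N%:R)) * (K * (M * M)).
have L0 : 0 <= L by rewrite !mulr_ge0.
have L1 : 0 < L + 1 by rewrite ltr_wpDl.
exists (e / 3 / (L + 1)) => [|h h0]; first by rewrite divr_gt0.
rewrite ltr_pdivlMr // => hL.
have h1 : slope_error N h <= e / 3 + e / 3.
  apply: lerD; last by apply: NP; rewrite mulrCA divff ?gt_eqF // mulr1.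
  rewrite mulrCA -/L; apply: le_trans (ltW hL); rewrite ler_pM2l // lerDl //.
have h2 := NP _ (rate_lim_tail_coord (uM _ s0) jN).
have := @u_slope N s (s + h) j jN s0; rewrite lerDl (ltW h0) => /(_ isT).
rewrite [s + h]addrC addrK => h3.
rewrite (_ : _ - _ = (u (h + s) j - u s j - h * rate N (u s) j) - h * (rate_lim (u s) j -
  rate N (u s) j)); last by ring.
apply: le_trans (ler_normB _ _) _; rewrite normrM gtr0_norm //.
apply: le_trans (lerD h3 (lexx _)) _; rewrite -mulrDr ler_pM2l //.
apply: le_trans (lerD h1 h2) _; rewrite le_eqVlt; apply/orP; left; apply/eqP; field.
Unshelve. all: by end_near. Qed.

End Euler.

End Truncations.

(** * Extended-real sums and integral equations *)

Section IntegralOfContinuous.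
Variable R : realType.
Local Notation mu := (@lebesgue_measure R).

Lemma within_segment_integrable (f : R -> R) (a b : R) :
  {within `[a, b], continuous f} -> mu.-integrable `[a, b] (EFin \o f).
Proof.
by move=> cf; apply: continuous_compact_integrable => //; exact: segment_compact.
Qed.

(** On the interval from [s] to [s + h], continuity makes [f] uniformly close to [f s]. Working from
    the right includes the endpoint [s = 0]. *)
Lemma Rintegral_right_deriv (f : R -> R) (b s : R) :
  {within `[0, b], continuous f} -> 0 <= s -> s < b ->
  right_deriv (fun t => \int[mu]_(x in `[0, t]) f x) s (f s).
Proof.
move=> cf s0 sb e e0.
have /within_continuous_epsP cf' := cf.
have [|d d0 dP] := cf' s _ _ e0; first by rewrite /= in_itv /= s0 ltW.
exists (Num.min d (b - s)) => [|h h0]; first by rewrite lt_min d0 subr_gt0.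
rewrite lt_min => /andP[hd hb].
have shb : s + h <= b by rewrite -lerBrDl ltW.
have int0 : mu.-integrable `[0, s + h] (EFin \o f).
  apply: within_segment_integrable; apply: continuous_subspaceW cf.
  by apply: subset_itvl; rewrite bnd_simp.
have ints : mu.-integrable `]s, s + h] (EFin \o f).
  apply: integrableS int0 => //.
  by apply: subset_itvr; rewrite bnd_simp.
have muI : fine (mu `]s, s + h]) = h.
  by rewrite lebesgue_measure_itv /= lte_fin ltrDl h0 /= addrAC subrr add0r.
have intc r : mu.-integrable `]s, s + h] (EFin \o cst r).
  apply: integrableS (within_segment_integrable (a := s) (b := s + h) _) => //.
    exact: subset_itv_oc_cc.
  by apply: continuous_subspaceT => ?; exact: cvg_cst.
rewrite Rintegral_itvB ?bnd_simp //; last by rewrite lerDl ltW.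
rewrite (_ : h * f s = \int[mu]_(x in `]s, s + h]) (cst (f s) x)); last first.
  by rewrite Rintegral_cst // muI mulrC.
rewrite -RintegralB //.
have intB : mu.-integrable `]s, s + h] (EFin \o (fun x => f x - cst (f s) x)).
  by rewrite (_ : EFin \o _ = (EFin \o f) \- (EFin \o cst (f s)))%E //;
    exact: integrableB.
apply: le_trans (le_normr_Rintegral _ intB) _ => //.
rewrite (_ : h * e = \int[mu]_(x in `]s, s + h]) (cst e x)); last first.
  by rewrite Rintegral_cst // muI mulrC.
apply: le_Rintegral => //; first exact: (integrable_norm intB).
move=> x; rewrite /= in_itv /= => /andP[sx xsh]; apply: ltW; apply: dP.
  by rewrite /= in_itv /= (le_trans s0 (ltW sx)) (le_trans xsh).
by rewrite gtr0_norm ?subr_gt0 // (le_lt_trans _ hd) // lerBlDl.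
Qed.

Lemma Rintegral_within_continuous (f : R -> R) (b : R) : 0 <= b ->
  {within `[0, b], continuous f} ->
  {within `[0, b], continuous (fun t => \int[mu]_(x in `[0, t]) f x)}.
Proof.
move=> b0 cf; exact: (parameterized_integral_continuous b0 (within_segment_integrable
  cf)).
Qed.

End IntegralOfContinuous.

(* The values at index 0 of kernels and states are junk. *)
Definition restrict_kernel (R : realType) (a : nat -> nat -> R) (j k : nat) : R :=
  if (0 < j)%N && (0 < k)%N then a j k else 0.

Definition clear0 (R : realType) (x : nat -> R) (j : nat) : R :=
  if (0 < j)%N then x j else 0.

Lemma sum_ord_from1 (R : realType) (f : nat -> R) n : f 0%N = 0 ->
  \sum_(k < n) f k = \sum_(1 <= k < n) f k.
Proof.
move=> f0; rewrite -(big_mkord predT f); case: n => [|n]; first by rewrite !big_geq.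
by rewrite big_ltn // f0 add0r.
Qed.

(** * From solutions of the integral equation to trajectories and back *)

Section Bridge.
Variables (R : realType) (a : nat -> nat -> R) (K : R).
Hypothesis a_sym : forall j k, (0 < j)%N -> (0 < k)%N -> a j k = a k j.
Hypothesis a_ge0 : forall j k, (0 < j)%N -> (0 < k)%N -> 0 <= a j k.
Hypothesis a_le : forall j k, (0 < j)%N -> (0 < k)%N -> a j k <= K * (w R j * w R k).
Hypothesis K_ge0 : 0 <= K.

Let a' := restrict_kernel a.

Let a'_sym j k : a' j k = a' k j.
Proof.
rewrite /a' /restrict_kernel andbC; case: ifP => // /andP[k0 j0]; exact: a_sym.
Qed.

Let a'_ge0 j k : 0 <= a' j k.
Proof. by rewrite /a' /restrict_kernel; case: ifP => // /andP[]; exact: a_ge0. Qed.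

Let a'_le j k : a' j k <= K * (w R j * w R k).
Proof.
rewrite /a' /restrict_kernel; case: ifP => [/andP[]|_]; first exact: a_le.
by rewrite !mulr_ge0 // w_ge0.
Qed.

Lemma norm1_le (M : R) (x : nat -> R) : (forall j, (0 < j)%N -> 0 <= x j) ->
  (forall N, \sum_(j < N) j%:R * x j <= M) -> (norm1 x <= M%:E)%E.
Proof.
move=> x0 xM; apply: lime_le.
  by apply: is_cvg_nneseries => j _ _; rewrite lee_fin mulr_ge0.
near=> n; rewrite -(big_mkcond predT) sumEFin lee_fin -sum_ord_from1 ?mul0r //.
apply: le_trans (xM n); apply: ler_sum => j _.
have [->|j0] := posnP j; first by rewrite !mul0r.
by rewrite ger0_norm ?x0.
Unshelve. all: by end_near. Qed.

Lemma norm1_ge (M : R) (x : nat -> R) : (forall j, (0 < j)%N -> 0 <= x j) ->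
  (norm1 x <= M%:E)%E -> forall N, \sum_(j < N) j%:R * x j <= M.
Proof.
move=> x0 xM N; rewrite -lee_fin; apply: le_trans xM.
apply: (@le_trans _ _ (\sum_(1 <= j < N) (j%:R * `|x j|)%:E)%E); last first.
  by apply: nneseries_lim_ge => j _ _; rewrite lee_fin mulr_ge0.
rewrite sumEFin lee_fin -sum_ord_from1 ?mul0r //; apply: ler_sum => j _.
by rewrite ler_wpM2l // ler_norm.
Qed.

Lemma mass_le_clear0 (M : R) (x : nat -> R) : (forall j, (0 < j)%N -> 0 <= x j) ->
  (norm1 x <= M%:E)%E -> mass_le M (clear0 x).
Proof.
move=> x0 xM; split=> [j|N].
  by rewrite /clear0; case: ifP => // /x0.
apply: le_trans (norm1_ge x0 xM N); apply: ler_sum => j _.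
rewrite /clear0; case: posnP => [->|//]; by rewrite !mul0r.
Qed.

(** On states of bounded mass both series have finite sums, so the extended-real difference is a
    difference of reals. *)
Lemma RBK_rateE (M : R) (x y : nat -> R) j : (0 < j)%N -> mass_le M y ->
  (forall k, (0 < k)%N -> y k = x k) ->
  (RBK_gain a x j - RBK_loss a x j)%E = (rate_lim a' y j)%:E.
Proof.
move=> j0 yM yx; rewrite /rate_lim EFinB; congr (_ - _)%E.
  rewrite /RBK_gain; apply: cvg_lim => //.
  (* Partial sums over [k < n] correspond to [i = k + j < n + j]; the term [k = 0] vanishes because
     the restricted kernel is 0 there. *)
  rewrite (_ : (fun n => _) = (fun n => (gain a' (n + j) y j)%:E)).
    apply: cvg_EFin; first by near=> n.
    have := @gain_cvg R a' K a'_ge0 a'_le K_ge0 M y yM j.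
    by rewrite -(cvg_shiftn j).
  apply/funext => n; rewrite sumEFin; congr (_%:E).
  pose F i := a' i (i - j)%N * y i * y (i - j)%N.
  have -> : gain a' (n + j) y j = \sum_(0 + j <= i < n + j) F i.
    by rewrite add0n (big_geq_mkord j (n + j) predT F).
  rewrite big_addn addnK big_mkord (@sum_ord_from1 R (fun k => F (k + j)%N)); last first.
    by rewrite /F add0n subnn /a' /restrict_kernel andbF !mul0r.
  rewrite /F.
  apply: eq_big_nat => k /andP[k1 _].
  have kj : (0 < j + k)%N by rewrite addn_gt0 j0.
  by rewrite addnK (addnC k j) /a' /restrict_kernel k1 kj !yx.
rewrite /RBK_loss; apply: cvg_lim => //.
rewrite (_ : (fun n => _) = (fun n => (loss a' n y j)%:E)).
  apply: cvg_EFin; first by near=> n.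
  exact: (@loss_cvg R a' K a'_ge0 a'_le K_ge0 M y yM j).
apply/funext => n; rewrite sumEFin; congr (_%:E).
rewrite /loss (@sum_ord_from1 R (fun k => a' j k * y j * y k)); last first.
  by rewrite /a' /restrict_kernel andbF !mul0r.
apply: eq_big_nat => k /andP[k1 _].
by rewrite /a' /restrict_kernel k1 j0 !yx.
Unshelve. all: by end_near. Qed.

Lemma RBK_integralE (M t : R) (c y : R -> nat -> R) j : (0 < j)%N ->
  (forall s, 0 <= s -> s <= t -> mass_le M (y s)) ->
  (forall s k, (0 < k)%N -> y s k = c s k) ->
  (forall k, {within `[0, t], continuous (fun s => y s k)}) ->
  (\int[lebesgue_measure]_(s in `[0%R, t])
     (RBK_gain a (c s) j - RBK_loss a (c s) j))%E =
  (\int[lebesgue_measure]_(s in `[0%R, t]) rate_lim a' (y s) j)%:E.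
Proof.
move=> j0 yM yc cy.
have yM' s : `[0, t]%classic s -> mass_le M (y s).
  by rewrite /= in_itv /= => /andP[]; exact: yM.
rewrite /Rintegral fineK; last first.
  apply: integrable_fin_num => //; apply: within_segment_integrable.
  exact: (@rate_lim_continuous R a' K a'_ge0 a'_le K_ge0 M _ y j yM' cy).
apply: eq_integral => s; rewrite inE => /yM' sM.
by apply: (RBK_rateE j0 sM) => k; exact: yc.
Qed.

(** The mass bound is the supremum of the norms. It makes the rate continuous in time, so the
    integral equation can be differentiated from the right. *)
Lemma solution_trajectory (T : \bar R) (c0 : nat -> R) (c : R -> nat -> R) (b : R) :
  time_interval T b -> RBK_solution a T c0 c ->
  exists M, trajectory a' M 0 b (fun t => clear0 (c t)).
Proof.
move=> [b0 bT] [cX c00 [cc supc] _ ceq].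
have inT t : 0 <= t -> t <= b -> time_interval T t.
  by move=> t0 tb; split=> //; apply: le_lt_trans bT; rewrite lee_fin.
set S := ereal_sup _ in supc.
have S0 : (0 <= S)%E.
  apply: (@le_trans _ _ (norm1 (c b))).
    by apply: nneseries_ge0 => n _ _; rewrite lee_fin mulr_ge0.
  by apply: ereal_sup_ubound; exists b => //; exact: inT.
exists (fine S).
have cM t : 0 <= t -> t <= b -> mass_le (fine S) (clear0 (c t)).
  move=> t0 tb; have tT := inT _ t0 tb; have [_ c_ge0] := cX _ tT.
  apply: mass_le_clear0 => //; rewrite fineK ?ge0_fin_numE //.
  by apply: ereal_sup_ubound; exists t.
have cc' k : {within `[0, b], continuous (fun t => clear0 (c t) k)}.
  rewrite /clear0; case: posnP => [_|k0].
    by apply: continuous_subspaceT => ?; exact: cvg_cst.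
  apply: continuous_subspaceW (cc k k0) => t; rewrite /= in_itv /= => /andP[].
  exact: inT.
split=> // j s j0 s0 sb.
have rc : {within `[0, b], continuous (fun t => rate_lim a' (clear0 (c t)) j)}.
  apply: (@rate_lim_continuous R a' K a'_ge0 a'_le K_ge0 (fine S)) cc' => t.
  by rewrite /= in_itv /= => /andP[]; exact: cM.
have cE t : 0 <= t -> t <= b -> clear0 (c t) j =
    c0 j + \int[lebesgue_measure]_(s in `[0, t]) rate_lim a' (clear0 (c s)) j.
  move=> t0 tb; rewrite /clear0 j0; apply: EFin_inj;
    rewrite (ceq _ _ j0 (inT _ t0 tb)) EFinD.
  congr (_ + _)%E; apply: (@RBK_integralE (fine S)) => //.
  - by move=> r r0 rt; apply: cM => //; exact: le_trans tb.
  - by move=> r k k0; rewrite /clear0 k0.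
  - move=> k; apply: continuous_subspaceW (cc' k).
    by apply: subset_itvl; rewrite bnd_simp.
move=> e e0; have [d d0 dP] := Rintegral_right_deriv rc s0 sb e0.
exists (Num.min d (b - s)) => [|h h0]; first by rewrite lt_min d0 subr_gt0.
rewrite lt_min => /andP[hd hb]; have := dP _ h0 hd.
rewrite !cE //; last 3 first.
- by rewrite ltW.
- by rewrite addr_ge0 // ltW.
- by rewrite -lerBrDl ltW.
by rewrite opprD addrACA subrr add0r.
Qed.

Lemma trajectory_solution (T : \bar R) (M : R) (c0 : nat -> R) (u : R -> nat -> R) :
  (forall j, (0 < j)%N -> u 0 j = c0 j) -> (forall b, 0 <= b -> trajectory a' M 0 b u) ->
  RBK_solution a T c0 u.
Proof.
move=> u0 uT.
have uM t : 0 <= t -> mass_le M (u t) by move=> t0; have [h _ _] := uT _ t0;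
  exact: h _ t0 (lexx t).
have uN t : 0 <= t -> (norm1 (u t) <= M%:E)%E.
  by move=> /uM[u_ge0 u_le]; exact: norm1_le.
have uc t k : 0 <= t -> {within `[0, t], continuous (fun s => u s k)}.
  by move=> t0; have [_ h _] := uT _ t0; exact: h.
split.
- move=> t [t0 _]; split; first by rewrite /X1 /= (le_lt_trans (uN _ t0)) ?ltry.
  by move=> j _; have [] := uM _ t0.
- exact: u0.
- split.
    move=> j _; apply/within_continuous_epsP => x [x0 xT] e e0.
    (* The segment up to [x + 1] contains a right neighbourhood of [x], whatever [T] is. *)
    have x10 : 0 <= x + 1 by rewrite addr_ge0.
    have /within_continuous_epsP cu := uc (x + 1) j x10.
    have [|d d0 dP] := cu x _ _ e0; first by rewrite /= in_itv /= x0 lerDl ler01.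
    exists (Num.min d 1) => [|z [z0 zT]]; first by rewrite lt_min d0 ltr01.
    rewrite lt_min => /andP[zd z1]; apply: dP => //.
    rewrite /= in_itv /= z0 -lerBlDl.
    by apply: le_trans (ltW z1); exact: ler_norm.
  apply: (@le_lt_trans _ _ M%:E); last exact: ltry.
  by apply: ge_ereal_sup => _ [t [t0 _] <-]; exact: uN.
- move=> j t j0 [t0 tT].
  have M0 : 0 <= M by exact: mass_le_ge0 (uM _ t0).
  have u_ge0 s k : 0 <= s -> 0 <= u s k by move=> s0; have [] := uM _ s0.
  (* The bound is constant in time, so its integral over [0, t] is finite. *)
  have bound s : 0 <= s ->
      (\sum_(1 <= k <oo) (a j k * u s k)%:E <= (K * w R j * M)%:E)%E.
    move=> s0; apply: lime_le.
      by apply: is_cvg_nneseries => k k0 _; rewrite lee_fin mulr_ge0 ?a_ge0 ?u_ge0.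
    near=> n; rewrite sumEFin lee_fin.
    apply: (@le_trans _ _ (\sum_(1 <= k < n) K * w R j * (w R k * u s k))).
      apply: ler_sum_nat => k /andP[k0 _].
      by rewrite mulrA ler_wpM2r ?u_ge0 // -mulrA a_le.
    rewrite -mulr_sumr ler_wpM2l ?mulr_ge0 ?w_ge0 //.
    rewrite -(@sum_ord_from1 R (fun k => w R k * u s k)); last by rewrite /w sqrtr0 mul0r.
    exact: (sum_w_le (uM _ s0)).
  apply: (@le_lt_trans _ _ (\int[lebesgue_measure]_(s in `[0%R, t]) (cst (K * w R j *
    M)%:E s))%E).
    apply: ge0_le_integral => //.
    - move=> s; rewrite /= in_itv /= => /andP[s0 _].
      by apply: nneseries_ge0 => k k0 _; rewrite lee_fin mulr_ge0 ?a_ge0 ?u_ge0.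
    - rewrite (_ : (fun s => _) =
          (fun s => \sum_(0 <= k <oo | (0 < k)%N) (a j k * u s k)%:E)%E); last first.
        by apply/funext => s; rewrite (eseries_cond _ xpredT 1).
      apply: (@ge0_emeasurable_sum _ _ _ _ (fun k s => (a j k * u s k)%:E) (fun k => 0 <
        k)%N).
        move=> k s; rewrite /= in_itv /= => /andP[s0 _] k0.
        by rewrite lee_fin mulr_ge0 ?a_ge0 ?u_ge0.
      move=> k k0; apply/measurable_EFinP; apply: measurable_funM => //.
      by apply: subspace_continuous_measurable_fun => //; exact: uc.
    - by move=> s; rewrite /= in_itv /= => /andP[s0 _]; exact: bound.
  rewrite integral_cst //= lebesgue_measure_itv /=.
  by case: ifP => _; rewrite ?mule0 ?ltry // -EFinB -EFinM ltry.
move=> j t j0 [t0 tT].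
have rc : {within `[0, t], continuous (fun s => rate_lim a' (u s) j)}.
  apply: (@rate_lim_continuous R a' K a'_ge0 a'_le K_ge0 M) (fun k => uc t k t0) => s.
  by rewrite /= in_itv /= => /andP[s0 _]; exact: uM.
rewrite (@RBK_integralE M t u u j j0) //; last 2 first.
- by move=> s s0 _; exact: uM.
- by move=> k; exact: uc.
rewrite -EFinD; congr (_%:E); rewrite -u0 //.
(* The component and the integral of its rate have the same right derivative, hence the same
   increment on [0, t]. *)
have := @right_deriv_unique R (fun s => u s j)
  (fun s => \int[lebesgue_measure]_(x in `[0, s]) rate_lim a' (u x) j) 0 t
  (fun s => rate_lim a' (u s) j) t0 (uc t j t0) (Rintegral_within_continuous t0 rc).
rewrite set_itv1 Rintegral_set1 subr0 => <-; first by rewrite subrKC.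
- by move=> s s0 st; have [_ _ h] := uT _ t0; exact: h.
- by move=> s s0 st; exact: Rintegral_right_deriv rc s0 st.
Unshelve. all: by end_near. Qed.

Lemma trajectory_density_nonincreasing (T : \bar R) (M : R) (u : R -> nat -> R) :
  (forall b, 0 <= b -> trajectory a' M 0 b u) -> density_nonincreasing T u.
Proof.
move=> uT t1 t2 [t10 _] [t20 _] t12.
have [uM uc ud] := uT _ t20.
have [u1_ge0 u1_le] := uM _ t10 t12; have [u2_ge0 _] := uM _ t20 (lexx _).
have n0 : (0 <= norm1 (u t1))%E.
  by apply: nneseries_ge0 => n _ _; rewrite lee_fin mulr_ge0.
have n1 : (norm1 (u t1) <= M%:E)%E by exact: norm1_le.
have n1E : (norm1 (u t1) = (fine (norm1 (u t1)))%:E)%E.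
  by rewrite fineK // ge0_fin_numE // (le_lt_trans n1) ?ltry.
have u12 : trajectory a' M t1 t2 u.
  split=> [t tt1 tt2|j|j s j0 ts1 ts2].
  - by apply: uM => //; exact: le_trans tt1.
  - by apply: continuous_subspaceW (uc j); apply: subset_itvr; rewrite bnd_simp.
  - by apply: ud => //; exact: le_trans ts1.
rewrite n1E; apply: norm1_le => // N.
apply: (@mass_nonincreasing R a' K a'_ge0 a'_le K_ge0 M t1 t2 u N) => //.
by apply: norm1_ge => //; rewrite -n1E.
Qed.

Lemma RBK_well_posed (T : \bar R) (c0 : nat -> R) : X1plus c0 ->
  exists c : R -> nat -> R,
    [/\ RBK_solution a T c0 c,
        density_nonincreasing T c
      & forall c' : R -> nat -> R, RBK_solution a T c0 c' ->
          forall (t : R) (j : nat), time_interval T t -> (0 < j)%N ->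
            c' t j = c t j].
Proof.
move=> [c0X c0_ge0].
have c0M : mass_le (fine (norm1 c0)) (clear0 c0).
  apply: mass_le_clear0 => //; rewrite fineK // ge0_fin_numE //.
  by apply: nneseries_ge0 => n _ _; rewrite lee_fin mulr_ge0.
have [u [u0 uT]] := @trajectory_exists R a' K a'_ge0 a'_le K_ge0 _ _ c0M.
have u0' j : (0 < j)%N -> u 0 j = c0 j by move=> j0; rewrite u0 /clear0 j0.
exists u; split.
- exact: trajectory_solution uT.
- exact: trajectory_density_nonincreasing uT.
move=> c' c'S t j tT j0; have [t0 _] := tT.
have [M c'T] := solution_trajectory tT c'S.
have c'0 k : (0 < k)%N -> clear0 (c' 0) k = u 0 k.
  by move=> k0; rewrite u0' // /clear0 k0; case: c'S => _ ->.
rewrite -[LHS](_ : clear0 (c' t) j = _); last by rewrite /clear0 j0.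
(* The stability estimate takes one mass bound for both trajectories; the larger one serves. *)
pose M' := Num.max M (fine (norm1 c0)).
apply: (@trajectory_unique R a' K a'_sym a'_ge0 a'_le K_ge0 M' t (fun t => clear0 (c' t))
  u) => //.
  by apply: trajectory_widen c'T; rewrite le_max lexx.
by apply: trajectory_widen (uT _ t0); rewrite le_max lexx orbT.
Qed.

End Bridge.

Theorem proposition5p1 (R : realType) (a : nat -> nat -> R)
    (a_sym : forall j k : nat, (0 < j)%N -> (0 < k)%N -> a j k = a k j)
    (a_ge0 : forall j k : nat, (0 < j)%N -> (0 < k)%N -> 0 <= a j k)
    (T : \bar R) (T_gt0 : (0 < T)%E)
    (a_bound : exists K beta : R, [/\ 0 < K, beta <= 1 / 2 &
       forall j k : nat, (0 < j)%N -> (0 < k)%N ->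
         a j k <= K * ((j%:R * k%:R) `^ beta)])
    (c0 : nat -> R) (c0_X1plus : X1plus c0) :
  exists c : R -> nat -> R,
    [/\ RBK_solution a T c0 c,
        density_nonincreasing T c
      & forall c' : R -> nat -> R,
          RBK_solution a T c0 c' -> density_nonincreasing T c' ->
          forall (t : R) (j : nat), time_interval T t -> (0 < j)%N ->
            c' t j = c t j].
Proof.
have [K [beta [K_gt0 beta_le a_le]]] := a_bound.
have beta_le' : beta <= 2^-1 by rewrite -[2^-1]div1r.
(* Since j k >= 1, powers increase with the exponent, so [beta] can be raised to 1/2, even from a
   negative value. *)
have a_le_w j k : (0 < j)%N -> (0 < k)%N -> a j k <= K * (w R j * w R k).
  move=> j0 k0; apply: le_trans (a_le j k j0 k0) _; rewrite ler_pM2l //.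
  rewrite /w -sqrtrM ?ler0n // -powR12_sqrt ?mulr_ge0 //.
  apply: ler_powR beta_le'.
  by rewrite -natrM ler1n muln_gt0 j0.
have [c [cS cD cU]] := RBK_well_posed a_sym a_ge0 a_le_w (ltW K_gt0) T c0_X1plus.
by exists c; split=> // c' c'S _; exact: cU.
Qed.
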